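(* Let $\sigma>0$, $\beta>0$ be fixed with $\lambda:=\frac{\sigma+1}{\beta+2}>\frac23$, and let $(k,B)$, $0<k<1$, $B>0$, be the unique solution of the system (S) given in the context. For $\rho$ sufficiently large let $\mathbf X_{\rm sym}=\mathbf X_{\rm sym}(\rho,\beta,\sigma)$ be the asymptotically stable symmetric periodic orbit of the Lorenz equations described in the context. Then for every initial condition in the basin of attraction of $\mathbf X_{\rm sym}$ the infinite time averages of $Z,Z^2,Z^3$ satisfy, as $\rho\to\infty$, $$\langle Z\rangle=\rho\left[1-\frac B\sigma\left(1-\frac{2E}{K}\right)\right]+O(\rho^{1/2}),$$ $$\langle Z^2\rangle=\rho^2\left[1-\frac{3\beta(K-2E)^2}{d_1^2K}\big(8e_1+\beta e_2\big)\right]+O(\rho^{3/2}),$$ $$\langle Z^3\rangle=\rho^3\left[1-\frac{9\beta(K-2E)^2}{5d_1^3K}\Big(20\,d_1e_1+\beta^2(K-2E)\big((32k^4-36k^2+19)K-(64k^4-64k^2+34)E\big)\Big)\right]+O(\rho^{5/2}),$$ where $K=K(k)$, $E=E(k)$, $e_1=(1-k^2)K+(2k^2-1)E$, $e_2=(4k^2-1)K+4(1-2k^2)E$, $d_1=4e_1+\beta e_2$. Moreover, the leading-order coefficients in square brackets for $\langle Z\rangle$ and $\langle Z^2\rangle$ are strictly less than $1$.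
   Context: The Lorenz equations are $X'=\sigma(Y-X)$, $Y'=\rho X-Y-XZ$, $Z'=-\beta Z+XY$ with $\sigma,\beta>0$. For a function $f$ of a solution $\mathbf X(t)=(X,Y,Z)(t)$, $\langle f(\mathbf X)\rangle:=\lim_{t\to\infty}\frac1t\int_0^tf(\mathbf X(s))\,ds$. For $0<k<1$ (elliptic modulus $k$), $K(k)=\int_0^1\frac{dt}{\sqrt{(1-t^2)(1-k^2t^2)}}$ and $E(k)=\int_0^1\sqrt{\frac{1-k^2t^2}{1-t^2}}\,dt$ are the complete elliptic integrals; $\mathrm{sn},\mathrm{cn},\mathrm{dn}$ are the Jacobi elliptic functions. System (S) for $(k,B)$: $$K\beta\sigma+\beta B(2E-K)-4B\sigma\big(E-(1-k^2)K\big)=0,$$ $$4B\big[(1-k^2)K+(2k^2-1)E\big]+3\beta\sigma(2E-K)+\beta B\big[(4k^2-1)K+4(1-2k^2)E\big]=0.$$ For $\lambda>2/3$ it has exactly one solution with $0<k<1$, $B>0$. With $\varepsilon=\rho^{-1/2}$, $X=\varepsilon^{-1}\xi$, $Y=\varepsilon^{-2}\sigma^{-1}\eta$, $Z=\varepsilon^{-2}(\sigma^{-1}\zeta+1)$, $t=\varepsilon\tau$, the Lorenz equations become $\dot\xi=\eta-\varepsilon\sigma\xi$, $\dot\eta=-\xi\zeta-\varepsilon\eta$, $\dot\zeta=\xi\eta-\varepsilon\beta(\zeta+\sigma)$. For sufficiently small $\varepsilon>0$ this rescaled system has an asymptotically stable periodic orbit, invariant under $(\xi,\eta,\zeta)\mapsto(-\xi,-\eta,\zeta)$,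 which is the unique periodic orbit in an order-$\varepsilon$ neighborhood of the periodic orbit $\xi=2k\sqrt B\,\mathrm{cn}(u,k)$, $\eta=-2kB\,\mathrm{dn}(u,k)\,\mathrm{sn}(u,k)$, $\zeta=B(1-2k^2\mathrm{sn}^2(u,k))$, $u=\sqrt B\tau$, of the system at $\varepsilon=0$, where $(k,B)$ solves (S). $\mathbf X_{\rm sym}(\rho,\beta,\sigma)$ is this orbit in the original variables. *)

(* Defs.v *)
From Stdlib Require Export Reals.
From Coquelicot Require Export Coquelicot.

Open Scope R_scope.

(** The second argument of the elliptic functions below is the modulus [k], not
    the parameter [m = k^2].  The integrands of [ellK] and [ellE] are singular
    at [1], hence the improper integrals. *)
Definition ellK (k : R) : R :=
  RInt_gen (fun t => / sqrt ((1 - t ^ 2) * (1 - k ^ 2 * t ^ 2)))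
           (at_point 0) (at_left 1).

Definition ellE (k : R) : R :=
  RInt_gen (fun t => sqrt ((1 - k ^ 2 * t ^ 2) / (1 - t ^ 2)))
           (at_point 0) (at_left 1).

Definition ellF (phi k : R) : R :=
  RInt (fun theta => / sqrt (1 - k ^ 2 * sin theta ^ 2)) 0 phi.

(** For [0 < k < 1], [fun phi => ellF phi k] is a bijection of [R], so this
    definite description is its inverse, the Jacobi amplitude. *)
Definition am (u k : R) : R := iota (fun phi : R => ellF phi k = u).

Definition sn (u k : R) : R := sin (am u k).
Definition cn (u k : R) : R := cos (am u k).
Definition dn (u k : R) : R := sqrt (1 - k ^ 2 * sn u k ^ 2).

(** Coquelicot's [norm] on this product is the Euclidean one. *)
Notation R3 := (R * R * R)%type.

Definition forward_solution (f : R3 -> R3) (x : R -> R3) : Prop :=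
  (forall t, 0 < t -> is_derive x t (f (x t))) /\
  filterlim x (at_right 0) (locally (x 0)).

Definition periodic_orbit (f : R3 -> R3) (G : R3 -> Prop) : Prop :=
  exists (x : R -> R3) (T : R),
    0 < T /\
    (forall t, is_derive x t (f (x t))) /\
    (forall t, x (t + T) = x t) /\
    (exists s t, x s <> x t) /\
    (forall p, G p <-> exists t, x t = p).

Definition near_set (G : R3 -> Prop) (r : R) (p : R3) : Prop :=
  exists q, G q /\ norm (minus p q) <= r.

Definition converges_to_set (x : R -> R3) (G : R3 -> Prop) : Prop :=
  forall e, 0 < e -> Rbar_locally p_infty (fun t => near_set G e (x t)).

(** Orbital, not pointwise, stability: only the distance to [G] matters. *)
Definition asymptotically_stable (f : R3 -> R3) (G : R3 -> Prop) : Prop :=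
  (forall e, 0 < e -> exists d, 0 < d /\
     forall x, forward_solution f x -> near_set G d (x 0) ->
     forall t, 0 <= t -> near_set G e (x t)) /\
  (exists d, 0 < d /\
     forall x, forward_solution f x -> near_set G d (x 0) ->
     converges_to_set x G).

Definition basin (f : R3 -> R3) (G : R3 -> Prop) (p : R3) : Prop :=
  exists x, forward_solution f x /\ x 0 = p /\ converges_to_set x G.

Definition is_time_average (g : R -> R) (l : R) : Prop :=
  is_lim (fun t => / t * RInt g 0 t) p_infty l.

Definition lorenz (sigma beta rho : R) (p : R3) : R3 :=
  let '(X, Y, Z) := p in
  (sigma * (Y - X), rho * X - Y - X * Z, - beta * Z + X * Y).

Definition Zcoord (p : R3) : R := let '(_, _, Z) := p in Z.

Definition rescaled (sigma beta eps : R) (p : R3) : R3 :=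
  let '(xi, eta, zeta) := p in
  (eta - eps * sigma * xi,
   - xi * zeta - eps * eta,
   xi * eta - eps * beta * (zeta + sigma)).

Definition to_lorenz (sigma eps : R) (p : R3) : R3 :=
  let '(xi, eta, zeta) := p in
  (/ eps * xi, / eps ^ 2 * / sigma * eta, / eps ^ 2 * (/ sigma * zeta + 1)).

Definition system_S (sigma beta k B : R) : Prop :=
  let K := ellK k in
  let E := ellE k in
  K * beta * sigma + beta * B * (2 * E - K)
    - 4 * B * sigma * (E - (1 - k ^ 2) * K) = 0 /\
  4 * B * ((1 - k ^ 2) * K + (2 * k ^ 2 - 1) * E)
    + 3 * beta * sigma * (2 * E - K)
    + beta * B * ((4 * k ^ 2 - 1) * K + 4 * (1 - 2 * k ^ 2) * E) = 0.

(** A periodic orbit of [rescaled sigma beta 0]. *)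
Definition limit_orbit (k B : R) (p : R3) : Prop :=
  exists tau, let u := sqrt B * tau in
    p = (2 * k * sqrt B * cn u k,
         - 2 * k * B * dn u k * sn u k,
         B * (1 - 2 * k ^ 2 * sn u k ^ 2)).

Definition symmetric_set (G : R3 -> Prop) : Prop :=
  forall xi eta zeta, G (xi, eta, zeta) -> G (- xi, - eta, zeta).

Definition in_tube (k B r : R) (G : R3 -> Prop) : Prop :=
  forall p, G p -> near_set (limit_orbit k B) r p.

(** The tube of radius [C * eps] is the order-[eps] neighborhood of the limit
    orbit in which [Gamma eps] is the unique periodic orbit. *)
Definition is_symmetric_orbit_family
    (sigma beta k B : R) (Gamma : R -> R3 -> Prop) : Prop :=
  exists C, 0 < C /\
    at_right 0 (fun eps =>
      periodic_orbit (rescaled sigma beta eps) (Gamma eps) /\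
      asymptotically_stable (rescaled sigma beta eps) (Gamma eps) /\
      symmetric_set (Gamma eps) /\
      in_tube k B (C * eps) (Gamma eps) /\
      (forall G, periodic_orbit (rescaled sigma beta eps) G ->
         in_tube k B (C * eps) G -> forall p, G p <-> Gamma eps p)).

(** [rescaled] at [eps = rho^(-1/2)] is [lorenz] in the variables of
    [to_lorenz], with time [t = eps * tau]. *)
Definition Xsym (sigma rho : R) (Gamma : R -> R3 -> Prop) (P : R3) : Prop :=
  let eps := Rpower rho (- (1 / 2)) in
  exists p, Gamma eps p /\ P = to_lorenz sigma eps p.

Definition e1 (k : R) : R :=
  (1 - k ^ 2) * ellK k + (2 * k ^ 2 - 1) * ellE k.

Definition e2 (k : R) : R :=
  (4 * k ^ 2 - 1) * ellK k + 4 * (1 - 2 * k ^ 2) * ellE k.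

Definition d1 (beta k : R) : R := 4 * e1 k + beta * e2 k.

Definition coefZ1 (sigma k B : R) : R :=
  1 - B / sigma * (1 - 2 * ellE k / ellK k).

Definition coefZ2 (beta k : R) : R :=
  1 - 3 * beta * (ellK k - 2 * ellE k) ^ 2 / (d1 beta k ^ 2 * ellK k)
      * (8 * e1 k + beta * e2 k).

Definition coefZ3 (beta k : R) : R :=
  1 - 9 * beta * (ellK k - 2 * ellE k) ^ 2 / (5 * d1 beta k ^ 3 * ellK k)
      * (20 * d1 beta k * e1 k
         + beta ^ 2 * (ellK k - 2 * ellE k)
           * ((32 * k ^ 4 - 36 * k ^ 2 + 19) * ellK k
              - (64 * k ^ 4 - 64 * k ^ 2 + 34) * ellE k)).

(* Main.v *)
Require Import Defs.
From Stdlib Require Import Lra Psatz.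

(** In the rescaled variables [Z = rho * (zeta / sigma + 1)].  A solution that
    converges to the periodic orbit follows, over each period, a piece of that
    orbit (Gronwall), so its averages exist and equal those over one period.
    The periodic orbit in turn follows, up to [O(eps)], a piece of the limit
    orbit over each window of length [2 K / sqrt B], on which the average of a
    function of [zeta] does not depend on the starting point.  Hence every
    average is that of the limit orbit up to [O(eps)], and the latter reduces to
    the moments of [1 - 2 k^2 sn^2], which are elementary in [K] and [E].  The
    second equation of (S) eliminates [B / sigma], and [e1 > 0], [e2 >= 0] give
    the sign of the corrections. *)

(** * Elliptic integrals and the Jacobi amplitude *)

(** The hypotheses place [Gamma eps] near the limit orbit only as a set and carry no estimate of its
    period or phase, while Gronwall bounds grow exponentially in time. Trajectories are therefore
    never compared for longer than a fixed time: at the start of each window the point on the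
    reference orbit is chosen anew. Errors then do not accumulate, and the unknown phase is harmless
    because the reference integral does not depend on it. This requires constants uniform in the
    starting time, and uniform in [eps] for the comparison with the limit orbit.

    The window [2 K / sqrt B] is half the period of the limit orbit. It suffices because [zeta]
    involves [sn] only through its square, and [sn] changes sign under [u + 2 K].

    One distance estimate, for systems with nonlinearity [(0, - X Z, X Y)], serves three purposes:
    perturbed against limit system (the terms of order [eps] being forcing), two solutions of the
    same system, and uniqueness (zero initial distance). *)

Definition Delta (k theta : R) : R := sqrt (1 - k ^ 2 * sin theta ^ 2).

Definition ellEinc (phi k : R) : R := RInt (Delta k) 0 phi.

Lemma radicand_pos (k theta : R) :
  0 < k < 1 -> 0 < 1 - k ^ 2 * sin theta ^ 2.
Proof.
  intros Hk.
  assert (H := SIN_bound theta).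
  assert (sin theta ^ 2 <= 1) by nra.
  assert (0 <= sin theta ^ 2) by nra.
  assert (k ^ 2 < 1) by nra.
  assert (0 < k ^ 2) by nra.
  nra.
Qed.

Lemma Delta_pos (k theta : R) : 0 < k < 1 -> 0 < Delta k theta.
Proof. intros Hk; apply sqrt_lt_R0, radicand_pos, Hk. Qed.

Lemma Delta_sqr (k theta : R) :
  0 < k < 1 -> Delta k theta ^ 2 = 1 - k ^ 2 * sin theta ^ 2.
Proof.
  intros Hk; unfold Delta; apply pow2_sqrt, Rlt_le, radicand_pos, Hk.
Qed.

Lemma Delta_le_1 (k theta : R) : Delta k theta <= 1.
Proof.
  unfold Delta; apply Rle_trans with (sqrt 1); [apply sqrt_le_1_alt|rewrite sqrt_1; lra].
  assert (0 <= k ^ 2 * sin theta ^ 2); [|lra].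
  apply Rmult_le_pos; apply pow2_ge_0.
Qed.

Lemma is_derive_Delta (k theta : R) : 0 < k < 1 ->
  is_derive (Delta k) theta
    (- (k ^ 2 * sin theta * cos theta) / Delta k theta).
Proof.
  intros Hk.
  assert (HD := Delta_pos k theta Hk).
  unfold Delta in *.
  auto_derive.
  - assert (H := radicand_pos k theta Hk); simpl in H; lra.
  - unfold Rminus in *; simpl in *; field; lra.
Qed.

Lemma continuous_Delta (k theta : R) :
  0 < k < 1 -> continuous (Delta k) theta.
Proof.
  intros Hk; apply (ex_derive_continuous (K := R_AbsRing) (V := R_NormedModule)).
  eexists; apply is_derive_Delta, Hk.
Qed.

Lemma continuous_inv_Delta (k theta : R) :
  0 < k < 1 -> continuous (fun x => / Delta k x) theta.
Proof.
  intros Hk; apply (ex_derive_continuous (K := R_AbsRing) (V := R_NormedModule)).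
  eexists; apply is_derive_inv.
  - apply is_derive_Delta, Hk.
  - assert (H := Delta_pos k theta Hk); lra.
Qed.

Lemma ex_RInt_continuous_all (h : R -> R) (a b : R) :
  (forall x, continuous h x) -> ex_RInt h a b.
Proof. intros Hh; apply (ex_RInt_continuous (V := R_CompleteNormedModule)); auto. Qed.

Lemma is_derive_primitive (h : R -> R) (a phi : R) :
  (forall x, continuous h x) ->
  is_derive (fun x => RInt h a x) phi (h phi).
Proof.
  intros Hh; apply (is_derive_RInt (V := R_NormedModule) h _ a); [|apply Hh].
  apply filter_forall; intros b.
  apply (RInt_correct (V := R_CompleteNormedModule)), ex_RInt_continuous_all, Hh.
Qed.

Lemma is_derive_0_const (f : R -> R) :
  (forall t, is_derive f t 0) -> forall a b, f a = f b.
Proof.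
  intros Hf a b.
  destruct (MVT_gen f a b (fun _ => 0)) as [c [_ Hc]]; [auto| |lra].
  intros x _; apply continuity_pt_filterlim, (ex_derive_continuous (K := R_AbsRing) (V := R_NormedModule)).
  now exists 0.
Qed.

(** Periodicity makes the increment over [PI] independent of [phi], its derivative being zero; the
    reflection about [PI / 2] makes the two halves of [[0, PI]] contribute equally. Hence the
    increments [2 K] and [2 E] of the incomplete integrals. *)
Lemma primitive_add_PI (h : R -> R) :
  (forall x, continuous h x) ->
  (forall x, h (x + PI) = h x) -> (forall x, h (PI - x) = h x) ->
  forall phi, RInt h 0 (phi + PI) = RInt h 0 phi + 2 * RInt h 0 (PI / 2).
Proof.
  intros Hc Hper Hrefl phi.
  set (H := (fun x => RInt h 0 x) : R -> R).
  assert (HD : forall x, is_derive H x (h x))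
    by (intros x; apply is_derive_primitive, Hc).
  assert (HE : forall x, ex_derive H x) by (intros x; eexists; apply HD).
  assert (H0 : H 0 = 0) by apply (RInt_point (V := R_CompleteNormedModule)).
  fold (H (phi + PI)) (H phi) (H (PI / 2)).
  clearbody H.
  assert (HU : forall x : R, Derive (fun y : R => H y) x = h x)
    by (intros x; apply is_derive_unique, HD).
  assert (Hshift : H (phi + PI) - H phi = H (0 + PI) - H 0).
  { apply (is_derive_0_const (fun x => H (x + PI) - H x)).
    intros t; auto_derive; [repeat split; apply HE|].
    rewrite !HU, Hper; ring. }
  assert (Hsym : H (PI - 0) + H 0 = H (PI - PI / 2) + H (PI / 2)).
  { apply (is_derive_0_const (fun x => H (PI - x) + H x)).
    intros t; auto_derive; [repeat split; apply HE|].
    rewrite !HU, <- (Hrefl t); unfold Rminus; ring. }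
  replace (PI - PI / 2) with (PI / 2) in Hsym by field.
  replace (PI - 0) with PI in Hsym by ring.
  replace (0 + PI) with PI in Hshift by ring.
  lra.
Qed.

Lemma sin_sqr_add_PI (x : R) : sin (x + PI) ^ 2 = sin x ^ 2.
Proof. rewrite neg_sin; ring. Qed.

Lemma sin_sqr_PI_sub (x : R) : sin (PI - x) ^ 2 = sin x ^ 2.
Proof. rewrite sin_PI_x; ring. Qed.

Lemma is_derive_asin (x : R) : -1 < x < 1 ->
  is_derive asin x (/ sqrt (1 - x ^ 2)).
Proof.
  intros Hx; apply is_derive_Reals.
  assert (H := derive_pt_asin x Hx).
  apply derive_pt_eq in H.
  replace (1 - x ^ 2) with (1 - x²) by (unfold Rsqr; ring).
  replace (/ sqrt (1 - x²)) with (1 / sqrt (1 - x²)) by (unfold Rdiv; ring).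
  exact H.
Qed.

(** The substitution [t = sin theta] absorbs the singularity at [1]: the primitive
    [RInt h 0 (asin b)] stays continuous up to [b = 1] although its derivative blows up. This links
    the improper integrals [ellK] and [ellE] to proper ones in the amplitude. *)
Lemma RInt_gen_sin_subst (h f : R -> R) :
  (forall x, continuous h x) ->
  (forall t, -1 < t < 1 -> f t = h (asin t) * / sqrt (1 - t ^ 2)) ->
  RInt_gen f (at_point 0) (at_left 1) = RInt h 0 (PI / 2).
Proof.
  intros Hc Hf.
  assert (HPI := PI_RGT_0).
  assert (Hint : forall b, 0 < b < 1 -> is_RInt f 0 b (RInt h 0 (asin b))).
  { intros b Hb.
    apply is_RInt_ext with (fun t => h (asin t) * / sqrt (1 - t ^ 2)).
    { intros t Ht; rewrite Rmin_left, Rmax_right in Ht by lra.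
      symmetry; apply Hf; lra. }
    replace (RInt h 0 (asin b))
      with (minus (RInt h 0 (asin b)) (RInt h 0 (asin 0))).
    2: { rewrite asin_0, (RInt_point (V := R_CompleteNormedModule)).
         apply (minus_zero_r (G := R_AbelianGroup)). }
    apply (is_RInt_derive (V := R_CompleteNormedModule)
             (fun t => RInt h 0 (asin t))); intros x Hx;
      rewrite Rmin_left, Rmax_right in Hx by lra.
    - rewrite Rmult_comm.
      apply (is_derive_comp (fun y => RInt h 0 y) asin).
      + apply is_derive_primitive, Hc.
      + apply is_derive_asin; lra.
    - apply (continuous_mult (K := R_AbsRing)).
      + apply continuous_comp; [|apply Hc].
        apply (ex_derive_continuous (K := R_AbsRing) (V := R_NormedModule)).
        eexists; apply is_derive_asin; lra.
      + apply (ex_derive_continuous (K := R_AbsRing) (V := R_NormedModule)).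
        assert (0 < 1 - x ^ 2) by nra.
        auto_derive; split; [nra|split; [|easy]].
        apply Rgt_not_eq, sqrt_lt_R0; nra. }
  apply (is_RInt_gen_unique (V := R_CompleteNormedModule)).
  apply (filterlimi_locally
           (fun (ab : R * R) y => is_RInt f (fst ab) (snd ab) y)).
  intros eps.
  assert (Hcont : continuous (fun y => RInt h 0 y) (PI / 2)).
  { apply (ex_derive_continuous (K := R_AbsRing) (V := R_NormedModule)).
    eexists; apply is_derive_primitive, Hc. }
  destruct (proj1 (filterlim_locally _ _) Hcont eps) as [d Hd].
  (* Left continuity of [asin] at [1] comes from the monotonicity of the sine: if [b] exceeds
     [sin (PI / 2 - d')], then [asin b] is within [d'] of [PI / 2]. The cap [1 < PI / 2] keeps
     [PI / 2 - d'] in the range where the sine increases. *)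
  set (d' := Rmin (d / 2) 1).
  assert (Hd' : 0 < d' /\ d' < d /\ d' <= 1).
  { assert (Hd0 := cond_pos d). unfold d'.
    repeat split; [apply Rmin_glb_lt; lra| |apply Rmin_r].
    apply Rle_lt_trans with (d / 2); [apply Rmin_l|lra]. }
  assert (HPI2 := PI2_1).
  assert (Hs : sin (PI / 2 - d') < 1).
  { rewrite <- sin_PI2; apply sin_increasing_1; lra. }
  apply Filter_prod with (fun a => a = 0)
    (fun b => 0 < b < 1 /\ sin (PI / 2 - d') < b).
  - easy.
  - assert (Hr : 0 < Rmin 1 (1 - sin (PI / 2 - d')))
      by (apply Rmin_glb_lt; lra).
    exists (mkposreal _ Hr); intros b Hb Hlt.
    change (Rabs (b - 1) < Rmin 1 (1 - sin (PI / 2 - d'))) in Hb.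
    apply Rabs_lt_between in Hb.
    assert (H1 := Rmin_l 1 (1 - sin (PI / 2 - d'))).
    assert (H2 := Rmin_r 1 (1 - sin (PI / 2 - d'))).
    lra.
  - intros a b -> [Hb Hsb].
    exists (RInt h 0 (asin b)); split; [apply Hint, Hb|].
    apply Hd. change (Rabs (asin b - PI / 2) < d).
    assert (Hab := asin_bound b).
    assert (PI / 2 - d' < asin b).
    { apply sin_increasing_0; try lra. rewrite sin_asin by lra. exact Hsb. }
    apply Rabs_lt_between; lra.
Qed.

Lemma ellK_ellF (k : R) : 0 < k < 1 -> ellK k = ellF (PI / 2) k.
Proof.
  intros Hk; unfold ellK, ellF.
  transitivity (RInt (fun theta => / Delta k theta) 0 (PI / 2)); [|reflexivity].
  apply RInt_gen_sin_subst.
  - intros x; apply continuous_inv_Delta, Hk.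
  - intros t Ht. unfold Delta. rewrite sin_asin by lra.
    rewrite sqrt_mult_alt by nra.
    rewrite Rinv_mult; ring.
Qed.

Lemma ellE_ellEinc (k : R) : 0 < k < 1 -> ellE k = ellEinc (PI / 2) k.
Proof.
  intros Hk; unfold ellE, ellEinc.
  apply RInt_gen_sin_subst.
  - intros x; apply continuous_Delta, Hk.
  - intros t Ht. unfold Delta. rewrite sin_asin by lra.
    rewrite sqrt_div_alt by nra.
    reflexivity.
Qed.

Lemma is_derive_ellF (k phi : R) : 0 < k < 1 ->
  is_derive (fun x => ellF x k) phi (/ Delta k phi).
Proof.
  intros Hk; apply (is_derive_primitive (fun theta => / Delta k theta)).
  intros x; apply continuous_inv_Delta, Hk.
Qed.

Lemma is_derive_ellEinc (k phi : R) : 0 < k < 1 ->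
  is_derive (fun x => ellEinc x k) phi (Delta k phi).
Proof.
  intros Hk; apply (is_derive_primitive (Delta k)).
  intros x; apply continuous_Delta, Hk.
Qed.

Lemma ellF_add_PI (k phi : R) : 0 < k < 1 ->
  ellF (phi + PI) k = ellF phi k + 2 * ellK k.
Proof.
  intros Hk; rewrite (ellK_ellF k Hk).
  apply (primitive_add_PI (fun theta => / Delta k theta)).
  - intros x; apply continuous_inv_Delta, Hk.
  - intros x; unfold Delta; now rewrite sin_sqr_add_PI.
  - intros x; unfold Delta; now rewrite sin_sqr_PI_sub.
Qed.

Lemma ellEinc_add_PI (k phi : R) : 0 < k < 1 ->
  ellEinc (phi + PI) k = ellEinc phi k + 2 * ellE k.
Proof.
  intros Hk; rewrite (ellE_ellEinc k Hk).
  apply (primitive_add_PI (Delta k)).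
  - intros x; apply continuous_Delta, Hk.
  - intros x; unfold Delta; now rewrite sin_sqr_add_PI.
  - intros x; unfold Delta; now rewrite sin_sqr_PI_sub.
Qed.

(** The integrand [/ Delta] is at least [1]. Injectivity and unboundedness of [ellF], positivity of
    [ellK] and the Lipschitz bound for [am] all follow from this. *)
Lemma ellF_expanding (k x y : R) : 0 < k < 1 -> x <= y ->
  y - x <= ellF y k - ellF x k.
Proof.
  intros Hk Hxy.
  destruct (MVT_gen (fun p => ellF p k) x y (fun p => / Delta k p))
    as [c [_ Hc]].
  - intros z _; apply is_derive_ellF, Hk.
  - intros z _; apply continuity_pt_filterlim.
    apply (ex_derive_continuous (K := R_AbsRing) (V := R_NormedModule) (fun p => ellF p k)).
    eexists; apply is_derive_ellF, Hk.
  - assert (HD := Delta_pos k c Hk). assert (HD1 := Delta_le_1 k c).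
    assert (1 <= / Delta k c).
    { rewrite <- Rinv_1; apply Rinv_le_contravar; lra. }
    simpl in Hc; nra.
Qed.

Lemma ellF_0 (k : R) : ellF 0 k = 0.
Proof. apply (RInt_point (V := R_CompleteNormedModule)). Qed.

Lemma ellF_inj (k x y : R) : 0 < k < 1 -> ellF x k = ellF y k -> x = y.
Proof.
  intros Hk H.
  destruct (Rle_or_lt x y) as [Hxy|Hxy].
  - assert (H1 := ellF_expanding k x y Hk Hxy); lra.
  - assert (H1 := ellF_expanding k y x Hk (Rlt_le _ _ Hxy)); lra.
Qed.

Lemma ellK_pos (k : R) : 0 < k < 1 -> 0 < ellK k.
Proof.
  intros Hk; rewrite (ellK_ellF k Hk).
  assert (HPI := PI_RGT_0).
  assert (H := ellF_expanding k 0 (PI / 2) Hk ltac:(lra)).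
  rewrite ellF_0 in H; lra.
Qed.

Lemma ellF_am (k u : R) : 0 < k < 1 -> ellF (am u k) k = u.
Proof.
  intros Hk; unfold am.
  apply (iota_correct (V := R_CompleteNormedModule) (fun phi => ellF phi k = u)).
  assert (Hex : exists phi, ellF phi k = u).
  { assert (Hc : continuity (fun p => ellF p k)).
    { intros z; apply continuity_pt_filterlim.
      apply (ex_derive_continuous (K := R_AbsRing) (V := R_NormedModule) (fun p => ellF p k)).
      eexists; apply is_derive_ellF, Hk. }
    (* Expansion from [0] gives [ellF] at least [Rabs u] at the right end and at most [- Rabs u] at
       the left end, so the intermediate value theorem reaches [u]. *)
    assert (H1 := ellF_expanding k 0 (Rabs u) Hk (Rabs_pos u)).
    assert (H2 := ellF_expanding k (- Rabs u) 0 Hk).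
    rewrite ellF_0 in *.
    assert (H3 := Rabs_pos u).
    assert (H4 := Rle_abs u). assert (H5 := Rle_abs (- u)).
    rewrite Rabs_Ropp in H5.
    destruct (IVT_gen (fun p => ellF p k) (- Rabs u) (Rabs u) u Hc)
      as [phi [_ Hphi]].
    - rewrite Rmin_left, Rmax_right by lra; lra.
    - now exists phi. }
  destruct Hex as [phi Hphi]; exists phi; split; [exact Hphi|].
  intros y Hy; apply (ellF_inj k); congruence.
Qed.

Lemma am_add_2K (k u : R) : 0 < k < 1 ->
  am (u + 2 * ellK k) k = am u k + PI.
Proof.
  intros Hk; apply (ellF_inj k _ _ Hk).
  rewrite ellF_add_PI, !ellF_am by exact Hk; reflexivity.
Qed.

Lemma am_lipschitz (k u v : R) : 0 < k < 1 ->
  Rabs (am v k - am u k) <= Rabs (v - u).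
Proof.
  intros Hk.
  assert (Hu := ellF_am k u Hk). assert (Hv := ellF_am k v Hk).
  destruct (Rle_or_lt (am u k) (am v k)) as [H|H].
  - assert (H1 := ellF_expanding k _ _ Hk H).
    rewrite !Rabs_pos_eq; lra.
  - assert (H1 := ellF_expanding k _ _ Hk (Rlt_le _ _ H)).
    rewrite Rabs_left, Rabs_left1; lra.
Qed.

(** The mean value theorem for [ellF] turns the difference quotient of its inverse into [Delta k c]
    with [c] between the two amplitudes; [am] being 1-Lipschitz, [c] tends to [am u k]. *)
Lemma is_derive_am (k u : R) : 0 < k < 1 ->
  is_derive (fun v => am v k) u (Delta k (am u k)).
Proof.
  intros Hk; apply is_derive_Reals; intros e He.
  assert (Hc := continuous_Delta k (am u k) Hk).
  destruct (proj1 (filterlim_locally _ _) Hc (mkposreal e He)) as [d Hd].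
  exists d; intros h Hh Hhd.
  destruct (MVT_gen (fun p => ellF p k) (am u k) (am (u + h) k)
              (fun p => / Delta k p)) as [c [Hc1 Hc2]].
  - intros z _; apply is_derive_ellF, Hk.
  - intros z _; apply continuity_pt_filterlim.
    apply (ex_derive_continuous (K := R_AbsRing) (V := R_NormedModule) (fun p => ellF p k)).
    eexists; apply is_derive_ellF, Hk.
  - simpl in Hc2; rewrite !ellF_am in Hc2 by exact Hk.
    assert (HD := Delta_pos k c Hk).
    replace ((am (u + h) k - am u k) / h) with (Delta k c).
    2: { replace (u + h - u) with h in Hc2 by ring.
         apply (f_equal (fun z => Delta k c * z / h)) in Hc2.
         replace (Delta k c * h / h) with (Delta k c) in Hc2 by (field; lra).
         rewrite Hc2; field; lra. }
    apply Hd; change (Rabs (c - am u k) < d).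
    apply Rle_lt_trans with (Rabs h); [|exact Hhd].
    replace h with (u + h - u) by ring.
    apply Rle_trans with (2 := am_lipschitz k u (u + h) Hk).
    unfold Rmin, Rmax in Hc1.
    destruct (Rle_dec (am u k) (am (u + h) k)).
    + rewrite !Rabs_pos_eq; lra.
    + rewrite !Rabs_left1; lra.
Qed.

(** * The limit orbit *)

Lemma is_derive_sn (k u : R) : 0 < k < 1 ->
  is_derive (fun v => sn v k) u (cn u k * dn u k).
Proof.
  intros Hk; rewrite Rmult_comm.
  apply (is_derive_comp sin (fun v => am v k)).
  - apply is_derive_sin.
  - apply is_derive_am, Hk.
Qed.

Lemma is_derive_cn (k u : R) : 0 < k < 1 ->
  is_derive (fun v => cn v k) u (- (sn u k * dn u k)).
Proof.
  intros Hk; replace (- (sn u k * dn u k)) with (dn u k * - sn u k) by ring.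
  apply (is_derive_comp cos (fun v => am v k)).
  - apply is_derive_cos.
  - apply is_derive_am, Hk.
Qed.

Lemma dn_pos (k u : R) : 0 < k < 1 -> 0 < dn u k.
Proof. apply Delta_pos. Qed.

Lemma dn_sqr (k u : R) : 0 < k < 1 -> dn u k ^ 2 = 1 - k ^ 2 * sn u k ^ 2.
Proof. apply Delta_sqr. Qed.

Lemma cn_sqr (k u : R) : cn u k ^ 2 = 1 - sn u k ^ 2.
Proof.
  unfold cn, sn; assert (H := sin2_cos2 (am u k)); unfold Rsqr in H; lra.
Qed.

Lemma is_derive_dn (k u : R) : 0 < k < 1 ->
  is_derive (fun v => dn v k) u (- (k ^ 2 * sn u k * cn u k)).
Proof.
  intros Hk.
  replace (- (k ^ 2 * sn u k * cn u k))
    with (dn u k * (- (k ^ 2 * sn u k * cn u k) / dn u k)).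
  2: { field. apply Rgt_not_eq, dn_pos, Hk. }
  apply (is_derive_comp (Delta k) (fun v => am v k)).
  - apply is_derive_Delta, Hk.
  - apply is_derive_am, Hk.
Qed.

(** Jacobi's epsilon function, the primitive of [dn ^ 2] that vanishes at [0]. It is the only
    non-elementary ingredient in the primitives of even powers of [sn]. *)
Definition epsilonJ (u k : R) : R := ellEinc (am u k) k.

Lemma is_derive_epsilonJ (k u : R) : 0 < k < 1 ->
  is_derive (fun v => epsilonJ v k) u (dn u k ^ 2).
Proof.
  intros Hk; replace (dn u k ^ 2) with (dn u k * dn u k) by ring.
  apply (is_derive_comp (fun p => ellEinc p k) (fun v => am v k)).
  - apply is_derive_ellEinc, Hk.
  - apply is_derive_am, Hk.
Qed.

Lemma sn_add_2K (k u : R) : 0 < k < 1 -> sn (u + 2 * ellK k) k = - sn u k.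
Proof. intros Hk; unfold sn; rewrite am_add_2K by exact Hk; apply neg_sin. Qed.

Lemma cn_add_2K (k u : R) : 0 < k < 1 -> cn (u + 2 * ellK k) k = - cn u k.
Proof. intros Hk; unfold cn; rewrite am_add_2K by exact Hk; apply neg_cos. Qed.

Lemma dn_add_2K (k u : R) : 0 < k < 1 -> dn (u + 2 * ellK k) k = dn u k.
Proof.
  intros Hk; unfold dn; rewrite sn_add_2K by exact Hk; f_equal; ring.
Qed.

Lemma epsilonJ_add_2K (k u : R) : 0 < k < 1 ->
  epsilonJ (u + 2 * ellK k) k = epsilonJ u k + 2 * ellE k.
Proof.
  intros Hk; unfold epsilonJ.
  rewrite am_add_2K, ellEinc_add_PI by exact Hk; reflexivity.
Qed.

Ltac jacobi_derive Hk :=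
  auto_derive;
  [ repeat split;
    match goal with
    | |- ex_derive (fun x => sn x _) _ => eexists; apply is_derive_sn, Hk
    | |- ex_derive (fun x => cn x _) _ => eexists; apply is_derive_cn, Hk
    | |- ex_derive (fun x => dn x _) _ => eexists; apply is_derive_dn, Hk
    | |- ex_derive (fun x => epsilonJ x _) _ =>
        eexists; apply is_derive_epsilonJ, Hk
    | |- _ => idtac
    end
  | ].

Lemma Derive_jacobi (k u : R) : 0 < k < 1 ->
  Derive (fun v : R => sn v k) u = cn u k * dn u k /\
  Derive (fun v : R => cn v k) u = - (sn u k * dn u k) /\
  Derive (fun v : R => dn v k) u = - (k ^ 2 * sn u k * cn u k) /\
  Derive (fun v : R => epsilonJ v k) u = dn u k ^ 2.
Proof.
  intros Hk; repeat split; apply is_derive_unique;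
    [apply is_derive_sn | apply is_derive_cn | apply is_derive_dn
    | apply is_derive_epsilonJ]; exact Hk.
Qed.

(** The averages of the first three powers of [1 - 2 k^2 sn^2] over any interval of length [2 K]. In
    particular [e2] is [3 K] times the mean square. *)
Definition mean1 (k : R) : R := (2 * ellE k - ellK k) / ellK k.
Definition mean2 (k : R) : R := e2 k / (3 * ellK k).
Definition mean3 (k : R) : R :=
  ((34 - 64 * k ^ 2 + 64 * k ^ 4) * ellE k
   - (19 - 36 * k ^ 2 + 32 * k ^ 4) * ellK k) / (15 * ellK k).

(* Antiderivatives of [(1 - 2 k^2 sn^2)^j], obtained by reducing [sn^4] and
   [sn^6] with the derivatives of [sn cn dn] and [sn^3 cn dn]. *)
Definition prim1 (k u : R) : R := 2 * epsilonJ u k - u.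
Definition prim2 (k u : R) : R :=
  ((4 * k ^ 2 - 1) * u + 4 * (1 - 2 * k ^ 2) * epsilonJ u k) / 3
  + 4 / 3 * k ^ 2 * (sn u k * cn u k * dn u k).
Definition prim3 (k u : R) : R :=
  ((34 - 64 * k ^ 2 + 64 * k ^ 4) * epsilonJ u k
   - (19 - 36 * k ^ 2 + 32 * k ^ 4) * u) / 15
  + sn u k * cn u k * dn u k
    * (k ^ 2 * (28 - 32 * k ^ 2) / 15 - 8 / 5 * k ^ 4 * sn u k ^ 2).

Lemma is_derive_prim1 (k u : R) : 0 < k < 1 ->
  is_derive (prim1 k) u (1 - 2 * k ^ 2 * sn u k ^ 2).
Proof.
  intros Hk; unfold prim1; jacobi_derive Hk.
  destruct (Derive_jacobi k u Hk) as [_ [_ [_ ->]]].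
  rewrite dn_sqr by exact Hk; ring.
Qed.

Lemma is_derive_prim2 (k u : R) : 0 < k < 1 ->
  is_derive (prim2 k) u ((1 - 2 * k ^ 2 * sn u k ^ 2) ^ 2).
Proof.
  intros Hk; unfold prim2; jacobi_derive Hk.
  destruct (Derive_jacobi k u Hk) as [-> [-> [-> ->]]].
  assert (Hd := dn_sqr k u Hk). assert (Hc := cn_sqr k u).
  revert Hd Hc; generalize (sn u k) (cn u k) (dn u k); intros s c d Hd Hc.
  (* In the middle term [c] and [d] occur only through their squares, so the Pythagorean relations
     leave a polynomial identity in [s] and [k]. *)
  transitivity
    ((4 * k ^ 2 - 1 + 4 * (1 - 2 * k ^ 2) * d ^ 2) / 3
     + 4 / 3 * k ^ 2 * (c ^ 2 * d ^ 2 - s ^ 2 * d ^ 2 - k ^ 2 * s ^ 2 * c ^ 2)).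
  - field.
  - rewrite Hd, Hc; field.
Qed.

Lemma is_derive_prim3 (k u : R) : 0 < k < 1 ->
  is_derive (prim3 k) u ((1 - 2 * k ^ 2 * sn u k ^ 2) ^ 3).
Proof.
  intros Hk; unfold prim3; jacobi_derive Hk.
  destruct (Derive_jacobi k u Hk) as [-> [-> [-> ->]]].
  assert (Hd := dn_sqr k u Hk). assert (Hc := cn_sqr k u).
  revert Hd Hc; generalize (sn u k) (cn u k) (dn u k); intros s c d Hd Hc.
  transitivity
    (((34 - 64 * k ^ 2 + 64 * k ^ 4) * d ^ 2 - (19 - 36 * k ^ 2 + 32 * k ^ 4)) / 15
     + (c ^ 2 * d ^ 2 - s ^ 2 * d ^ 2 - k ^ 2 * s ^ 2 * c ^ 2)
       * (k ^ 2 * (28 - 32 * k ^ 2) / 15 - 8 / 5 * k ^ 4 * s ^ 2)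
     - 16 / 5 * k ^ 4 * s ^ 2 * (c ^ 2 * d ^ 2)).
  - field.
  - rewrite Hd, Hc; field.
Qed.

(** The product [sn * cn * dn] returns to its value, since [sn] and [cn] both change sign. Only the
    linear and the [epsilonJ] terms contribute, and their increments do not depend on [u]. *)
Lemma prim_add_2K (k u : R) : 0 < k < 1 ->
  prim1 k (u + 2 * ellK k) - prim1 k u = 2 * ellK k * mean1 k /\
  prim2 k (u + 2 * ellK k) - prim2 k u = 2 * ellK k * mean2 k /\
  prim3 k (u + 2 * ellK k) - prim3 k u = 2 * ellK k * mean3 k.
Proof.
  intros Hk; assert (HK := ellK_pos k Hk).
  unfold prim1, prim2, prim3, mean1, mean2, mean3, e2.
  rewrite sn_add_2K, cn_add_2K, dn_add_2K, epsilonJ_add_2K by exact Hk.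
  repeat split; field; lra.
Qed.

(** Pointwise, [Delta <= 1 <= / Delta]. *)
Lemma ellE_bounds (k : R) : 0 < k < 1 -> 0 <= ellE k <= ellK k.
Proof.
  intros Hk; assert (HPI := PI_RGT_0).
  rewrite (ellE_ellEinc k Hk), (ellK_ellF k Hk); unfold ellEinc, ellF.
  assert (HcD : forall x, continuous (Delta k) x)
    by (intros; now apply continuous_Delta).
  assert (HcI : forall x, continuous (fun t => / Delta k t) x)
    by (intros; now apply continuous_inv_Delta).
  split.
  - apply RInt_ge_0; [lra|now apply ex_RInt_continuous_all|].
    intros x _; apply Rlt_le, Delta_pos, Hk.
  - apply RInt_le; [lra|now apply ex_RInt_continuous_all| |].
    + apply (ex_RInt_continuous_all (fun t => / Delta k t)), HcI.
    + intros x _; fold (Delta k x).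
      assert (H0 := Delta_pos k x Hk); assert (H1 := Delta_le_1 k x).
      apply Rle_trans with 1; [exact H1|].
      rewrite <- Rinv_1; apply Rinv_le_contravar; lra.
Qed.

(** If [k^2 >= 1/2], both summands are nonnegative and the first is positive. Otherwise [E <= K]
    leaves at least [k^2 K]. *)
Lemma e1_pos (k : R) : 0 < k < 1 -> 0 < e1 k.
Proof.
  intros Hk; unfold e1.
  assert (HK := ellK_pos k Hk); destruct (ellE_bounds k Hk) as [H0 H1].
  assert (0 < k ^ 2 < 1) by nra.
  generalize dependent (k ^ 2); intros m Hm.
  destruct (Rle_or_lt (1 / 2) m); nra.
Qed.

(* [e2 / 3] is the integral of [(1 - 2 k^2 sn^2)^2] over [[0, K]]. *)
Lemma e2_nonneg (k : R) : 0 < k < 1 -> 0 <= e2 k.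
Proof.
  intros Hk; assert (HK := ellK_pos k Hk).
  destruct (prim_add_2K k 0 Hk) as [_ [H _]].
  destruct (MVT_gen (prim2 k) 0 (0 + 2 * ellK k)
              (fun u => (1 - 2 * k ^ 2 * sn u k ^ 2) ^ 2)) as [c [_ Hc]].
  - intros; now apply is_derive_prim2.
  - intros x _; apply continuity_pt_filterlim.
    apply (ex_derive_continuous (K := R_AbsRing) (V := R_NormedModule)).
    eexists; apply is_derive_prim2, Hk.
  - rewrite Hc in H; unfold mean2 in H.
    replace (2 * ellK k * (e2 k / (3 * ellK k))) with (2 / 3 * e2 k) in H
      by (field; lra).
    assert (H2 := pow2_ge_0 (1 - 2 * k ^ 2 * sn c k ^ 2)).
    simpl in *; nra.
Qed.

Definition limX (k B tau : R) : R := 2 * k * sqrt B * cn (sqrt B * tau) k.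
Definition limY (k B tau : R) : R :=
  - 2 * k * B * dn (sqrt B * tau) k * sn (sqrt B * tau) k.
Definition limZ (k B tau : R) : R :=
  B * (1 - 2 * k ^ 2 * sn (sqrt B * tau) k ^ 2).

Lemma is_derive_limX (k B tau : R) : 0 < k < 1 -> 0 < B ->
  is_derive (limX k B) tau (limY k B tau).
Proof.
  intros Hk HB; unfold limX, limY; jacobi_derive Hk.
  destruct (Derive_jacobi k (sqrt B * tau) Hk) as [_ [-> _]].
  (* The bare factor [B] of [limY] is to be read as [sqrt B ^ 2]: one root comes from the amplitude
     of [limX], the other from the chain rule. *)
  rewrite <- (pow2_sqrt B) at 5 by lra; ring.
Qed.

Lemma is_derive_limY (k B tau : R) : 0 < k < 1 -> 0 < B ->
  is_derive (limY k B) tau (- limX k B tau * limZ k B tau).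
Proof.
  intros Hk HB; unfold limX, limY, limZ; jacobi_derive Hk.
  destruct (Derive_jacobi k (sqrt B * tau) Hk) as [-> [_ [-> _]]].
  assert (Hd := dn_sqr k (sqrt B * tau) Hk).
  transitivity (- 2 * k * B * sqrt B * cn (sqrt B * tau) k
    * (dn (sqrt B * tau) k ^ 2 - k ^ 2 * sn (sqrt B * tau) k ^ 2)); [ring|].
  rewrite Hd; ring.
Qed.

Lemma is_derive_limZ (k B tau : R) : 0 < k < 1 -> 0 < B ->
  is_derive (limZ k B) tau (limX k B tau * limY k B tau).
Proof.
  intros Hk HB; unfold limX, limY, limZ; jacobi_derive Hk.
  destruct (Derive_jacobi k (sqrt B * tau) Hk) as [-> _]; ring.
Qed.

(** A period of [limZ] but only half a period of the orbit: [limX] and [limY] change sign over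
    it. *)
Definition window (k B : R) : R := 2 * ellK k / sqrt B.

Lemma window_pos (k B : R) : 0 < k < 1 -> 0 < B -> 0 < window k B.
Proof.
  intros Hk HB; assert (HK := ellK_pos k Hk).
  apply Rdiv_lt_0_compat; [lra|apply sqrt_lt_R0, HB].
Qed.

(** Here [z = 1 - 2 k^2 sn^2], and [limZ / sigma + 1 = 1 + (B / sigma) z]. An arbitrary cubic in [z]
    thus covers the first three powers of the limit of [Z / rho] at once, for every starting point
    [s]. *)
Lemma RInt_window_cubic (k B a0 a1 a2 a3 s : R) : 0 < k < 1 -> 0 < B ->
  RInt (fun r => let z := limZ k B (s + r) / B in
                 a0 + a1 * z + a2 * z ^ 2 + a3 * z ^ 3) 0 (window k B)
  = window k B * (a0 + a1 * mean1 k + a2 * mean2 k + a3 * mean3 k).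
Proof.
  intros Hk HB; assert (HK := ellK_pos k Hk).
  assert (Hs : 0 < sqrt B) by apply sqrt_lt_R0, HB.
  set (u := fun r => sqrt B * (s + r)).
  set (G := fun r => a0 * r + (a1 * prim1 k (u r) + a2 * prim2 k (u r)
                               + a3 * prim3 k (u r)) / sqrt B).
  apply (is_RInt_unique (V := R_CompleteNormedModule)).
  replace (window k B * _) with (minus (G (window k B)) (G 0)).
  2: { change (G (window k B) - G 0 = window k B *
         (a0 + a1 * mean1 k + a2 * mean2 k + a3 * mean3 k)).
       unfold G.
       replace (u (window k B)) with (u 0 + 2 * ellK k).
       2: { unfold u, window; field; lra. }
       destruct (prim_add_2K k (u 0) Hk) as [H1 [H2 H3]].
       replace (prim1 k (u 0 + 2 * ellK k))
         with (prim1 k (u 0) + 2 * ellK k * mean1 k) by lra.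
       replace (prim2 k (u 0 + 2 * ellK k))
         with (prim2 k (u 0) + 2 * ellK k * mean2 k) by lra.
       replace (prim3 k (u 0 + 2 * ellK k))
         with (prim3 k (u 0) + 2 * ellK k * mean3 k) by lra.
       unfold window; field; lra. }
  assert (HDu : forall r, is_derive u r (sqrt B))
    by (intros r; unfold u; auto_derive; [easy|ring]).
  assert (HDG : forall r, is_derive G r
     (let z := limZ k B (s + r) / B in a0 + a1 * z + a2 * z ^ 2 + a3 * z ^ 3)).
  { intros r; unfold G.
    auto_derive.
    - repeat split; eexists;
        [apply is_derive_prim1|apply HDu|apply is_derive_prim2|apply HDu
        |apply is_derive_prim3|apply HDu]; exact Hk.
    - replace (Derive (fun x : R => prim1 k x) (u r))
        with (1 - 2 * k ^ 2 * sn (u r) k ^ 2)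
        by (symmetry; apply is_derive_unique, is_derive_prim1, Hk).
      replace (Derive (fun x : R => prim2 k x) (u r))
        with ((1 - 2 * k ^ 2 * sn (u r) k ^ 2) ^ 2)
        by (symmetry; apply is_derive_unique, is_derive_prim2, Hk).
      replace (Derive (fun x : R => prim3 k x) (u r))
        with ((1 - 2 * k ^ 2 * sn (u r) k ^ 2) ^ 3)
        by (symmetry; apply is_derive_unique, is_derive_prim3, Hk).
      replace (Derive (fun x : R => u x) r) with (sqrt B)
        by (symmetry; apply is_derive_unique, HDu).
      unfold limZ; fold (u r); field; lra. }
  apply (is_RInt_derive (V := R_CompleteNormedModule) G); intros r _; [apply HDG|].
  apply (ex_derive_continuous (K := R_AbsRing) (V := R_NormedModule)).
  assert (ex_derive (limZ k B) (s + r)) by (eexists; now apply is_derive_limZ).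
  cbv zeta; auto_derive; tauto.
Qed.

(** * Continuous dependence for fields of Lorenz type *)

Lemma nonincreasing_open (v v' : R -> R) (a b : R) :
  a <= b -> (forall t, continuous v t) ->
  (forall t, a < t < b -> is_derive v t (v' t) /\ v' t <= 0) ->
  v b <= v a.
Proof.
  intros Hab Hv Hd.
  (* [Rmin (v' t) 0] agrees with [v'] inside and is nonpositive at the
     endpoints too, where [MVT_gen] may place the mean value point. *)
  destruct (MVT_gen v a b (fun t => Rmin (v' t) 0)) as [c [_ Hc]].
  - rewrite Rmin_left, Rmax_right by exact Hab; intros t Ht.
    destruct (Hd t Ht) as [H1 H2]; rewrite Rmin_left by exact H2; exact H1.
  - intros t _; apply continuity_pt_filterlim, Hv.
  - assert (H := Rmin_r (v' c) 0); nra.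
Qed.

(** The function [w s * exp (- L s) - c s] does not increase: its derivative is at most
    [c * exp (- L s) - c], and the exponential is at most [1]. The inequality is asked only on the
    open interval, since forward solutions need not be differentiable at [0]. *)
Lemma gronwall (w w' : R -> R) (L c T : R) :
  0 <= L -> 0 <= c ->
  (forall t, continuous w t) ->
  (forall t, 0 < t < T -> is_derive w t (w' t) /\ w' t <= L * w t + c) ->
  forall t, 0 <= t <= T -> w t <= (w 0 + c * t) * exp (L * t).
Proof.
  intros HL Hc Hw Hd t Ht.
  set (v := fun s => w s * exp (- (L * s)) - c * s).
  assert (Hv : v t <= v 0).
  { apply nonincreasing_open
      with (fun s => (w' s - L * w s) * exp (- (L * s)) - c); [lra| |].
    - intros s; unfold v.
      apply (continuous_minus (V := R_NormedModule)
               (fun s => w s * exp (- (L * s)))).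
      + apply (continuous_mult (K := R_AbsRing)); [apply Hw|].
        apply (ex_derive_continuous (K := R_AbsRing) (V := R_NormedModule)).
        now auto_derive.
      + apply (ex_derive_continuous (K := R_AbsRing) (V := R_NormedModule)).
        now auto_derive.
    - intros s Hs; destruct (Hd s) as [H1 H2]; [lra|]; split.
      + unfold v; auto_derive; [eexists; exact H1|].
        replace (Derive (fun x : R => w x) s) with (w' s)
          by (symmetry; apply is_derive_unique, H1).
        ring.
      + assert (H3 := exp_pos (- (L * s))).
        assert (exp (- (L * s)) <= 1).
        { rewrite <- exp_0; destruct (Req_dec (L * s) 0) as [->|Hne].
          - rewrite Ropp_0; lra.
          - apply Rlt_le, exp_increasing.
            assert (0 <= L * s) by nra; lra. }
        nra. }
  unfold v in Hv; rewrite Rmult_0_r, Ropp_0, exp_0 in Hv.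
  assert (H3 := exp_pos (L * t)).
  assert (H4 : exp (- (L * t)) * exp (L * t) = 1)
    by (rewrite <- exp_plus, Rplus_opp_l; apply exp_0).
  replace (w t) with (w t * exp (- (L * t)) * exp (L * t))
    by (rewrite Rmult_assoc, H4; ring).
  apply Rmult_le_compat_r; lra.
Qed.

(** A common frame for the Lorenz, the rescaled and the limit system. The free coefficients and
    forcing terms allow the terms of order [eps] to be counted as either. *)
Definition forced_solution (a b c d e : R) (u v w X Y Z : R -> R) : Prop :=
  (forall t, continuous X t /\ continuous Y t /\ continuous Z t) /\
  (forall t, 0 < t ->
     is_derive X t (a * Y t - b * X t + u t) /\
     is_derive Y t (c * X t - d * Y t - X t * Z t + v t) /\
     is_derive Z t (X t * Y t - e * Z t + w t)).

Definition bounded_on (M T : R) (X Y Z : R -> R) : Prop :=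
  forall t, 0 <= t <= T -> Rabs (X t) <= M /\ Rabs (Y t) <= M /\ Rabs (Z t) <= M.

Lemma two_mul_le (q m x y : R) : Rabs q <= m ->
  2 * (q * x * y) <= m * (x ^ 2 + y ^ 2).
Proof.
  intros Hq.
  assert (H1 : 2 * (x * y) <= x ^ 2 + y ^ 2)
    by (assert (H := pow2_ge_0 (x - y)); lra).
  assert (H2 : - (2 * (x * y)) <= x ^ 2 + y ^ 2)
    by (assert (H := pow2_ge_0 (x + y)); lra).
  apply Rabs_le_between in Hq.
  assert (0 <= m + q) by lra. assert (0 <= m - q) by lra.
  nra.
Qed.

(** Gronwall for the squared distance, each product difference being split into a bounded factor
    times a difference. [C] is chosen before the coefficients and the solutions, which makes the
    bound uniform in [eps] and in the starting time. *)
Lemma forced_solution_dist (A M T : R) : 0 <= A -> 0 <= M -> 0 <= T ->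
  exists C, 0 <= C /\
  forall a b c d e, Rabs a <= A -> Rabs b <= A -> Rabs c <= A ->
    Rabs d <= A -> Rabs e <= A ->
  forall u1 v1 w1 X1 Y1 Z1 u2 v2 w2 X2 Y2 Z2 r,
    forced_solution a b c d e u1 v1 w1 X1 Y1 Z1 ->
    forced_solution a b c d e u2 v2 w2 X2 Y2 Z2 ->
    bounded_on M T X1 Y1 Z1 -> bounded_on M T X2 Y2 Z2 ->
    (forall t, 0 < t < T -> Rabs (u1 t - u2 t) <= r /\
       Rabs (v1 t - v2 t) <= r /\ Rabs (w1 t - w2 t) <= r) ->
    Rabs (X1 0 - X2 0) <= r -> Rabs (Y1 0 - Y2 0) <= r ->
    Rabs (Z1 0 - Z2 0) <= r ->
    forall t, 0 <= t <= T ->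
      Rabs (X1 t - X2 t) <= C * r /\ Rabs (Y1 t - Y2 t) <= C * r /\
      Rabs (Z1 t - Z2 t) <= C * r.
Proof.
  intros HA HM HT.
  (* Estimating each summand by [two_mul_le] puts at most [4 A + 3 M + 1] on every square, so this
     [L] has slack. The [3] in [C2] counts the coordinates, [1 + T] collects the initial and the
     forcing error, and the root undoes the squaring. *)
  set (L := 5 * A + 4 * M + 1).
  set (C2 := 3 * (1 + T) * exp (L * T)).
  assert (HL : 0 <= L) by (unfold L; lra).
  assert (HC2 : 0 <= C2)
    by (unfold C2; assert (H := exp_pos (L * T)); nra).
  exists (sqrt C2); split; [apply sqrt_pos|].
  intros a b c d e Ha Hb Hc Hd He u1 v1 w1 X1 Y1 Z1 u2 v2 w2 X2 Y2 Z2 r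
    [Hc1 Hd1] [Hc2 Hd2] HB1 HB2 Hf H0x H0y H0z t Ht.
  assert (Hr : 0 <= r) by (assert (H := Rabs_pos (X1 0 - X2 0)); lra).
  set (W := fun s => (X1 s - X2 s) ^ 2 + (Y1 s - Y2 s) ^ 2 + (Z1 s - Z2 s) ^ 2).
  assert (Hsq : forall x m, Rabs x <= m -> x ^ 2 <= m ^ 2).
  { intros x m Hx; rewrite <- (pow2_abs x); apply pow_incr.
    split; [apply Rabs_pos|exact Hx]. }
  set (dX s := a * (Y1 s - Y2 s) - b * (X1 s - X2 s) + (u1 s - u2 s)).
  set (dY s := c * (X1 s - X2 s) - d * (Y1 s - Y2 s)
               - (X1 s * Z1 s - X2 s * Z2 s) + (v1 s - v2 s)).
  set (dZ s := X1 s * Y1 s - X2 s * Y2 s - e * (Z1 s - Z2 s) + (w1 s - w2 s)).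
  assert (HW : W t <= C2 * r ^ 2).
  { assert (HG : W t <= (W 0 + 3 * r ^ 2 * t) * exp (L * t)).
    { apply (gronwall W (fun s => 2 * (X1 s - X2 s) * dX s
         + 2 * (Y1 s - Y2 s) * dY s + 2 * (Z1 s - Z2 s) * dZ s) L (3 * r ^ 2) T);
        [exact HL|nra| | |exact Ht].
      - intros s; destruct (Hc1 s) as [? [? ?]]; destruct (Hc2 s) as [? [? ?]].
        unfold W; simpl.
        repeat match goal with
        | |- continuous (fun _ => _ + _) _ => apply (continuous_plus (V := R_NormedModule))
        | |- continuous (fun _ => _ - _) _ => apply (continuous_minus (V := R_NormedModule))
        | |- continuous (fun _ => _ * _) _ => apply (continuous_mult (K := R_AbsRing))
        | |- continuous (fun _ => 1) _ => apply continuous_const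
        | |- _ => assumption
        end.
      - intros s Hs.
        destruct (Hd1 s) as [Hx1 [Hy1 Hz1]]; [lra|].
        destruct (Hd2 s) as [Hx2 [Hy2 Hz2]]; [lra|].
        split.
        + unfold W; auto_derive.
          * repeat split; eexists; eassumption.
          * replace (Derive (fun x => X1 x) s) with (a * Y1 s - b * X1 s + u1 s)
              by (symmetry; apply is_derive_unique, Hx1).
            replace (Derive (fun x => X2 x) s) with (a * Y2 s - b * X2 s + u2 s)
              by (symmetry; apply is_derive_unique, Hx2).
            replace (Derive (fun x => Y1 x) s)
              with (c * X1 s - d * Y1 s - X1 s * Z1 s + v1 s)
              by (symmetry; apply is_derive_unique, Hy1).
            replace (Derive (fun x => Y2 x) s)
              with (c * X2 s - d * Y2 s - X2 s * Z2 s + v2 s)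
              by (symmetry; apply is_derive_unique, Hy2).
            replace (Derive (fun x => Z1 x) s) with (X1 s * Y1 s - e * Z1 s + w1 s)
              by (symmetry; apply is_derive_unique, Hz1).
            replace (Derive (fun x => Z2 x) s) with (X2 s * Y2 s - e * Z2 s + w2 s)
              by (symmetry; apply is_derive_unique, Hz2).
            unfold dX, dY, dZ; ring.
        + destruct (HB1 s) as [Bx1 [By1 Bz1]]; [lra|].
          destruct (HB2 s) as [Bx2 [By2 Bz2]]; [lra|].
          destruct (Hf s) as [Fu [Fv Fw]]; [lra|].
          unfold W, dX, dY, dZ, L.
          apply Hsq in Fu; apply Hsq in Fv; apply Hsq in Fw.
          assert (HbN : Rabs (- b) <= A) by (rewrite Rabs_Ropp; exact Hb).
          assert (HdN : Rabs (- d) <= A) by (rewrite Rabs_Ropp; exact Hd).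
          assert (HeN : Rabs (- e) <= A) by (rewrite Rabs_Ropp; exact He).
          assert (HxN : Rabs (- X1 s) <= M) by (rewrite Rabs_Ropp; exact Bx1).
          assert (HzN : Rabs (- Z2 s) <= M) by (rewrite Rabs_Ropp; exact Bz2).
          assert (H1 : Rabs 1 <= 1) by (rewrite Rabs_R1; lra).
          set (x := X1 s - X2 s); set (y := Y1 s - Y2 s); set (z := Z1 s - Z2 s).
          fold x in Fu |- *.
          replace (X1 s * Z1 s - X2 s * Z2 s) with (X1 s * z + Z2 s * x)
            by (unfold x, z; ring).
          replace (X1 s * Y1 s - X2 s * Y2 s) with (X1 s * y + Y2 s * x)
            by (unfold x, y; ring).
          assert (G1 := two_mul_le a A x y Ha).
          assert (G2 := two_mul_le (- b) A x x HbN).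
          assert (G3 := two_mul_le 1 1 x (u1 s - u2 s) H1).
          assert (G4 := two_mul_le c A y x Hc).
          assert (G5 := two_mul_le (- d) A y y HdN).
          assert (G6 := two_mul_le (- X1 s) M y z HxN).
          assert (G7 := two_mul_le (- Z2 s) M y x HzN).
          assert (G8 := two_mul_le 1 1 y (v1 s - v2 s) H1).
          assert (G9 := two_mul_le (X1 s) M z y Bx1).
          assert (G10 := two_mul_le (Y2 s) M z x By2).
          assert (G11 := two_mul_le (- e) A z z HeN).
          assert (G12 := two_mul_le 1 1 z (w1 s - w2 s) H1).
          assert (P1 := Rmult_le_pos _ _ HA (pow2_ge_0 x)).
          assert (P2 := Rmult_le_pos _ _ HA (pow2_ge_0 y)).
          assert (P3 := Rmult_le_pos _ _ HA (pow2_ge_0 z)).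
          assert (Q1 := Rmult_le_pos _ _ HM (pow2_ge_0 x)).
          assert (Q2 := Rmult_le_pos _ _ HM (pow2_ge_0 y)).
          assert (Q3 := Rmult_le_pos _ _ HM (pow2_ge_0 z)).
          lra. }
    assert (HW0 : W 0 <= 3 * r ^ 2).
    { unfold W; apply Hsq in H0x; apply Hsq in H0y; apply Hsq in H0z; lra. }
    assert (Hexp : exp (L * t) <= exp (L * T)).
    { destruct (Req_dec (L * t) (L * T)) as [->|Hne]; [lra|].
      apply Rlt_le, exp_increasing; assert (L * t <= L * T) by nra; lra. }
    assert (HE := exp_pos (L * t)).
    apply Rle_trans with (1 := HG).
    replace (C2 * r ^ 2) with ((3 * r ^ 2 * (1 + T)) * exp (L * T))
      by (unfold C2; ring).
    assert (0 <= r ^ 2) by apply pow2_ge_0.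
    apply Rle_trans with ((3 * r ^ 2 * (1 + T)) * exp (L * t)).
    - apply Rmult_le_compat_r; [lra|]; nra.
    - apply Rmult_le_compat_l; [nra|exact Hexp]. }
  assert (Hroot : forall x, x ^ 2 <= W t -> Rabs x <= sqrt C2 * r).
  { intros x Hx; rewrite <- (sqrt_pow2 r Hr), <- sqrt_mult by (nra || apply pow2_ge_0).
    rewrite <- sqrt_Rsqr_abs; apply sqrt_le_1_alt; unfold Rsqr; lra. }
  unfold W in Hroot.
  assert (P1 := pow2_ge_0 (X1 t - X2 t)).
  assert (P2 := pow2_ge_0 (Y1 t - Y2 t)).
  assert (P3 := pow2_ge_0 (Z1 t - Z2 t)).
  repeat split; apply Hroot; lra.
Qed.

Lemma forced_solution_shift (a b c d e : R) (u v w X Y Z : R -> R) (s : R) :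
  0 <= s -> forced_solution a b c d e u v w X Y Z ->
  forced_solution a b c d e (fun t => u (s + t)) (fun t => v (s + t))
    (fun t => w (s + t)) (fun t => X (s + t)) (fun t => Y (s + t))
    (fun t => Z (s + t)).
Proof.
  intros Hs [Hc Hd].
  assert (Hsh : forall t, is_derive (fun x : R => s + x) t 1)
    by (intros t; auto_derive; [easy|ring]).
  split.
  - intros t; destruct (Hc (s + t)) as [H1 [H2 H3]].
    assert (Hcs : continuous (fun x : R => s + x) t).
    { apply (ex_derive_continuous (K := R_AbsRing) (V := R_NormedModule)).
      eexists; apply Hsh. }
    repeat split; apply (continuous_comp (fun x : R => s + x)); assumption.
  - assert (Hcomp : forall (f : R -> R) (t l : R), is_derive f (s + t) l ->
              is_derive (fun x : R => f (s + x)) t l).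
    { intros f t l Hf; replace l with (1 * l) by ring.
      apply (is_derive_comp f (fun x : R => s + x)); [exact Hf|apply Hsh]. }
    intros t Ht; destruct (Hd (s + t)) as [H1 [H2 H3]]; [lra|].
    exact (conj (Hcomp _ _ _ H1) (conj (Hcomp _ _ _ H2) (Hcomp _ _ _ H3))).
Qed.

(** * Averages over windows *)

Lemma continuous_bounded (g : R -> R) (a b : R) : a <= b ->
  (forall t, continuous g t) ->
  exists M, 0 <= M /\ forall t, a <= t <= b -> Rabs (g t) <= M.
Proof.
  intros Hab Hg.
  destruct (continuity_ab_maj (fun t => Rabs (g t)) a b Hab) as [m [Hm _]].
  - intros t _; apply continuity_pt_filterlim.
    apply (continuous_comp g Rabs); [apply Hg|].
    apply continuity_pt_filterlim, Rcontinuity_abs.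
  - exists (Rabs (g m)); split; [apply Rabs_pos|exact Hm].
Qed.

Lemma RInt_shift (g : R -> R) (s T : R) : (forall t, continuous g t) ->
  RInt (fun r => g (s + r)) 0 T = RInt g s (s + T).
Proof.
  intros Hg.
  assert (H := RInt_comp_lin (V := R_CompleteNormedModule) g 1 s 0 T).
  rewrite !Rmult_1_l, Rplus_0_l, (Rplus_comm T) in H.
  rewrite <- H by (apply ex_RInt_continuous_all, Hg).
  apply (RInt_ext (V := R_CompleteNormedModule)); intros x _.
  change (g (s + x) = 1 * g (1 * x + s)).
  rewrite !Rmult_1_l, Rplus_comm; reflexivity.
Qed.

(** The deviation [H] from linear growth changes in absolute value by at most [delta] per window, so
    its size is its maximum [C] on the first window after [t0] plus [delta] for each further one. *)
Lemma RInt_from_windows (g : R -> R) (T I delta t0 : R) :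
  0 < T -> 0 <= delta -> 0 <= t0 -> (forall t, continuous g t) ->
  (forall t, t0 <= t -> Rabs (RInt (fun r => g (t + r)) 0 T - I) <= delta) ->
  exists C, forall t, t0 <= t ->
    Rabs (RInt g 0 t - t * (I / T)) <= C + delta * (t / T).
Proof.
  intros HT Hdelta Ht0 Hg Hwin.
  set (H := fun t => RInt g 0 t - t * (I / T)).
  assert (HcH : forall t, continuous H t).
  { intros t; unfold H.
    apply (continuous_minus (V := R_NormedModule) (fun t => RInt g 0 t));
      apply (ex_derive_continuous (K := R_AbsRing) (V := R_NormedModule)).
    - eexists; apply is_derive_primitive, Hg.
    - now auto_derive. }
  assert (Hstep : forall t, t0 <= t -> Rabs (H (t + T)) <= Rabs (H t) + delta).
  { intros t Ht.
    assert (HCh := RInt_Chasles (V := R_CompleteNormedModule) g 0 t (t + T)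
      (ex_RInt_continuous_all g 0 t Hg) (ex_RInt_continuous_all g t (t + T) Hg)).
    change (RInt g 0 t + RInt g t (t + T) = RInt g 0 (t + T)) in HCh.
    assert (Hw := Hwin t Ht); rewrite (RInt_shift g t T Hg) in Hw.
    replace (H (t + T)) with (H t + (RInt g t (t + T) - I)).
    2: { unfold H; rewrite <- HCh; field; lra. }
    apply Rle_trans with (1 := Rabs_triang _ _); lra. }
  destruct (continuous_bounded H t0 (t0 + T)) as [C [HC0 HC]]; [lra|exact HcH|].
  exists C.
  assert (Hn : forall (n : nat) t, t0 <= t <= t0 + INR n * T ->
            Rabs (H t) <= C + delta * ((t - t0) / T)).
  { induction n as [|n IHn]; intros t Ht.
    - simpl in Ht; replace t with t0 by lra.
      assert (Hx := HC t0 ltac:(lra)).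
      replace ((t0 - t0) / T) with 0 by (field; lra); lra.
    - rewrite S_INR in Ht.
      destruct (Rle_or_lt t (t0 + T)) as [Hle|Hlt].
      + assert (Hx := HC t ltac:(lra)).
        assert (0 <= delta * ((t - t0) / T)); [|lra].
        apply Rmult_le_pos; [exact Hdelta|].
        apply Rdiv_le_0_compat; lra.
      + assert (Hx := Hstep (t - T) ltac:(lra)).
        replace (t - T + T) with t in Hx by ring.
        assert (Hy := IHn (t - T) ltac:(nra)).
        replace ((t - t0) / T) with ((t - T - t0) / T + 1) by (field; lra).
        lra. }
  intros t Ht.
  (* The floor only gives [(t - t0) / T < n + 1], so [S n] windows are needed to reach [t]. *)
  destruct (nfloor_ex ((t - t0) / T)) as [n [_ Hn2]].
  { apply Rdiv_le_0_compat; lra. }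
  assert (Htn : t <= t0 + INR (S n) * T).
  { rewrite S_INR; apply (Rmult_lt_compat_r T) in Hn2; [|exact HT].
    replace ((t - t0) / T * T) with (t - t0) in Hn2 by (field; lra); lra. }
  apply Rle_trans with (1 := Hn (S n) t (conj Ht Htn)).
  apply Rplus_le_compat_l, Rmult_le_compat_l; [exact Hdelta|].
  apply Rmult_le_compat_r; [apply Rlt_le, Rinv_0_lt_compat, HT|lra].
Qed.

Lemma time_average_near (g : R -> R) (T I delta t0 : R) :
  0 < T -> 0 <= delta -> 0 <= t0 -> (forall t, continuous g t) ->
  (forall t, t0 <= t -> Rabs (RInt (fun r => g (t + r)) 0 T - I) <= delta) ->
  forall eta, 0 < eta ->
  exists t1, forall t, t1 < t ->
    Rabs (/ t * RInt g 0 t - I / T) <= delta / T + eta.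
Proof.
  intros HT Hdelta Ht0 Hg Hwin eta Heta.
  destruct (RInt_from_windows g T I delta t0 HT Hdelta Ht0 Hg Hwin) as [C HC].
  (* Beyond [Rabs C / eta] the constant [C] adds at most [eta] to the average. *)
  exists (Rmax t0 (Rabs C / eta)); intros t Ht.
  assert (H1 := Rmax_l t0 (Rabs C / eta)).
  assert (H2 := Rmax_r t0 (Rabs C / eta)).
  assert (HCe : 0 <= Rabs C / eta)
    by (apply Rdiv_le_0_compat; [apply Rabs_pos|exact Heta]).
  assert (Htp : 0 < t) by lra.
  assert (Hx := HC t ltac:(lra)).
  replace (/ t * RInt g 0 t - I / T) with (/ t * (RInt g 0 t - t * (I / T)))
    by (field; lra).
  rewrite Rabs_mult, (Rabs_pos_eq (/ t)) by (apply Rlt_le, Rinv_0_lt_compat, Htp).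
  apply Rmult_le_reg_l with t; [exact Htp|].
  rewrite <- Rmult_assoc, Rinv_r, Rmult_1_l by lra.
  apply Rle_trans with (1 := Hx).
  assert (C <= eta * t).
  { apply Rle_trans with (1 := Rle_abs C).
    replace (Rabs C) with (eta * (Rabs C / eta)) by (field; lra).
    apply Rmult_le_compat_l; lra. }
  replace (t * (delta / T + eta)) with (eta * t + delta * (t / T)) by (field; lra).
  lra.
Qed.

Lemma is_time_average_iff (g : R -> R) (l : R) :
  is_time_average g l <->
  forall eta, 0 < eta -> exists t1, forall t, t1 < t ->
    Rabs (/ t * RInt g 0 t - l) <= eta.
Proof.
  unfold is_time_average; rewrite <- is_lim_spec; split.
  - intros H eta Heta; destruct (H (mkposreal eta Heta)) as [t1 Ht1].
    exists t1; intros t Ht; apply Rlt_le, (Ht1 t Ht).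
  - intros H eps; assert (He := cond_pos eps).
    destruct (H (eps / 2)) as [t1 Ht1]; [lra|].
    exists t1; intros t Ht; simpl.
    apply Rle_lt_trans with (1 := Ht1 t Ht); lra.
Qed.

(** Qualitative version: the window errors become arbitrarily small, which also yields existence of
    the average. *)
Lemma is_time_average_windows (g : R -> R) (T I : R) :
  0 < T -> (forall t, continuous g t) ->
  (forall delta, 0 < delta -> exists t0, 0 <= t0 /\ forall t, t0 <= t ->
     Rabs (RInt (fun r => g (t + r)) 0 T - I) <= delta) ->
  is_time_average g (I / T).
Proof.
  intros HT Hg Hwin; apply is_time_average_iff; intros eta Heta.
  destruct (Hwin (T * (eta / 2))) as [t0 [Ht0 Hw]]; [nra|].
  destruct (time_average_near g T I (T * (eta / 2)) t0) with (eta / 2)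
    as [t1 Ht1]; try assumption; try nra.
  exists t1; intros t Ht; apply Rle_trans with (1 := Ht1 t Ht).
  apply Req_le; field; lra.
Qed.

(** Quantitative version: a fixed error [delta] per window cannot give existence, so the average is
    supposed to exist and only its value is estimated. *)
Lemma time_average_dist (g : R -> R) (T I delta l : R) :
  0 < T -> 0 <= delta -> (forall t, continuous g t) ->
  is_time_average g l ->
  (forall t, 0 <= t -> Rabs (RInt (fun r => g (t + r)) 0 T - I) <= delta) ->
  Rabs (l - I / T) <= delta / T.
Proof.
  intros HT Hdelta Hg Hl Hwin.
  apply le_epsilon; intros eta Heta.
  destruct (time_average_near g T I delta 0) with (eta / 2) as [t1 Ht1];
    try assumption; try lra.
  destruct (proj1 (is_time_average_iff g l) Hl (eta / 2)) as [t2 Ht2]; [lra|].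
  set (t := Rmax t1 t2 + 1).
  assert (H1 := Rmax_l t1 t2); assert (H2 := Rmax_r t1 t2).
  specialize (Ht1 t ltac:(unfold t; lra)); specialize (Ht2 t ltac:(unfold t; lra)).
  replace (l - I / T) with (- (/ t * RInt g 0 t - l) + (/ t * RInt g 0 t - I / T))
    by ring.
  apply Rle_trans with (1 := Rabs_triang _ _); rewrite Rabs_Ropp; lra.
Qed.

(** * Averages along orbits close to the limit orbit *)

(** Continuity of the observable would give convergence of the averages as [eps] tends to [0]; the
    rate [O(eps)] comes from a Lipschitz constant on the bounded region containing the orbits. *)
Definition locally_lipschitz (phi : R -> R) : Prop :=
  forall M, 0 <= M -> exists Lam, 0 <= Lam /\
    forall x y, Rabs x <= M -> Rabs y <= M ->
      Rabs (phi x - phi y) <= Lam * Rabs (x - y).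

Lemma locally_lipschitz_continuous (phi : R -> R) (x : R) :
  locally_lipschitz phi -> continuous phi x.
Proof.
  intros Hphi.
  destruct (Hphi (Rabs x + 1)) as [Lam [HLam H]];
    [assert (H0 := Rabs_pos x); lra|].
  apply filterlim_locally; intros eps; assert (He := cond_pos eps).
  assert (Hd : 0 < Rmin 1 (eps / (Lam + 1))).
  { apply Rmin_glb_lt; [lra|apply Rdiv_lt_0_compat; lra]. }
  exists (mkposreal _ Hd); intros y Hy.
  change (Rabs (y - x) < Rmin 1 (eps / (Lam + 1))) in Hy.
  change (Rabs (phi y - phi x) < eps).
  assert (H1 := Rmin_l 1 (eps / (Lam + 1))).
  assert (H2 := Rmin_r 1 (eps / (Lam + 1))).
  assert (H3 : Rabs y <= Rabs x + 1).
  { replace y with (x + (y - x)) by ring.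
    apply Rle_trans with (1 := Rabs_triang _ _); lra. }
  apply Rle_lt_trans with (1 := H y x H3 ltac:(lra)).
  assert (H4 : Rabs (y - x) * (Lam + 1) < eps).
  { replace (pos eps) with (eps / (Lam + 1) * (Lam + 1)) by (field; lra).
    apply Rmult_lt_compat_r; lra. }
  assert (H5 := Rabs_pos (y - x)); nra.
Qed.

(** Applied with [c = / sigma], where [z * c + 1] is [Z / rho]. *)
Lemma locally_lipschitz_affine_pow (c : R) (n : nat) :
  locally_lipschitz (fun z => (z * c + 1) ^ n).
Proof.
  intros M HM.
  set (N := M * Rabs c + 1).
  assert (HN : 0 <= N)
    by (unfold N; assert (H := Rmult_le_pos _ _ HM (Rabs_pos c)); lra).
  assert (Hb : forall x, Rabs x <= M -> Rabs (x * c + 1) <= N).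
  { intros x Hx; apply Rle_trans with (1 := Rabs_triang _ _).
    rewrite Rabs_mult, Rabs_R1; unfold N.
    apply Rplus_le_compat_r, Rmult_le_compat_r; [apply Rabs_pos|exact Hx]. }
  induction n as [|n [Lam [HLam IH]]].
  - exists 0; split; [lra|]; intros x y _ _; simpl.
    rewrite Rminus_diag, Rabs_R0; lra.
  - exists (Rabs c * N ^ n + N * Lam).
    assert (HNn : 0 <= N ^ n) by (now apply pow_le).
    split; [assert (H := Rabs_pos c); nra|].
    intros x y Hx Hy.
    replace ((x * c + 1) ^ S n - (y * c + 1) ^ S n)
      with ((x - y) * c * (x * c + 1) ^ n
            + (y * c + 1) * ((x * c + 1) ^ n - (y * c + 1) ^ n))
      by (simpl; ring).
    apply Rle_trans with (1 := Rabs_triang _ _).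
    rewrite !Rabs_mult, Rmult_plus_distr_r.
    apply Rplus_le_compat.
    + rewrite <- RPow_abs, (Rmult_comm (Rabs (x - y))), !Rmult_assoc.
      apply Rmult_le_compat_l; [apply Rabs_pos|].
      rewrite Rmult_comm; apply Rmult_le_compat_r; [apply Rabs_pos|].
      apply pow_incr; split; [apply Rabs_pos|now apply Hb].
    + rewrite Rmult_assoc; apply Rmult_le_compat;
        [apply Rabs_pos|apply Rabs_pos|now apply Hb|now apply IH].
Qed.

Lemma RInt_dist (g1 g2 : R -> R) (T m : R) : 0 <= T ->
  (forall t, continuous g1 t) -> (forall t, continuous g2 t) ->
  (forall t, 0 <= t <= T -> Rabs (g1 t - g2 t) <= m) ->
  Rabs (RInt g1 0 T - RInt g2 0 T) <= T * m.
Proof.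
  intros HT Hc1 Hc2 Hm.
  assert (E1 := ex_RInt_continuous_all g1 0 T Hc1).
  assert (E2 := ex_RInt_continuous_all g2 0 T Hc2).
  assert (H := RInt_minus (V := R_CompleteNormedModule) g1 g2 0 T E1 E2).
  change (RInt (fun x => g1 x - g2 x) 0 T = RInt g1 0 T - RInt g2 0 T) in H.
  rewrite <- H.
  replace (T * m) with ((T - 0) * m) by ring.
  apply abs_RInt_le_const; [exact HT| |exact Hm].
  apply ex_RInt_continuous_all; intros t.
  apply (continuous_minus (V := R_NormedModule)); auto.
Qed.

Definition rescaled_solution (sigma beta eps : R) (X Y Z : R -> R) : Prop :=
  forced_solution 1 (eps * sigma) 0 eps (eps * beta)
    (fun _ => 0) (fun _ => 0) (fun _ => - (eps * beta * sigma)) X Y Z.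

(** Splitting a vector field into coefficients and forcing is not unique. Along a given solution
    this moves terms from one to the other, which turns the rescaled system into the limit system
    with forcing of order [eps]. *)
Lemma forced_solution_ext (a b c d e a' b' c' d' e' : R)
    (u v w u' v' w' X Y Z : R -> R) :
  forced_solution a b c d e u v w X Y Z ->
  (forall t, a * Y t - b * X t + u t = a' * Y t - b' * X t + u' t) ->
  (forall t, c * X t - d * Y t - X t * Z t + v t
             = c' * X t - d' * Y t - X t * Z t + v' t) ->
  (forall t, X t * Y t - e * Z t + w t = X t * Y t - e' * Z t + w' t) ->
  forced_solution a' b' c' d' e' u' v' w' X Y Z.
Proof.
  intros [Hc Hd] HX HY HZ; split; [exact Hc|].
  intros t Ht; rewrite <- HX, <- HY, <- HZ; exact (Hd t Ht).
Qed.

(** The separate bounds are [2 sqrt B], [2 B] and [B]; their sum serves all coordinates. *)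
Lemma limit_bounded (k B : R) : 0 < k < 1 -> 0 < B ->
  forall t, Rabs (limX k B t) <= 2 * sqrt B + 3 * B /\
            Rabs (limY k B t) <= 2 * sqrt B + 3 * B /\
            Rabs (limZ k B t) <= 2 * sqrt B + 3 * B.
Proof.
  intros Hk HB t; unfold limX, limY, limZ.
  set (u := sqrt B * t).
  assert (Hs : 0 < sqrt B) by apply sqrt_lt_R0, HB.
  assert (Hd : 0 < dn u k) by (apply dn_pos, Hk).
  assert (Hd1 : dn u k <= 1) by apply Delta_le_1.
  assert (Hsn : -1 <= sn u k <= 1) by apply SIN_bound.
  assert (Hcn : -1 <= cn u k <= 1) by apply COS_bound.
  assert (Hks : 0 <= k ^ 2 * sn u k ^ 2 <= 1).
  { assert (H := radicand_pos k (am u k) Hk); split; [|unfold sn; lra].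
    apply Rmult_le_pos; apply pow2_ge_0. }
  assert (Hkc : -1 <= k * cn u k <= 1) by nra.
  assert (Hkd : 0 <= k * dn u k <= 1) by nra.
  assert (Hkds : -1 <= k * dn u k * sn u k <= 1) by nra.
  repeat split; apply Rabs_le_between.
  - replace (2 * k * sqrt B * cn u k) with (2 * sqrt B * (k * cn u k)) by ring.
    nra.
  - replace (- 2 * k * B * dn u k * sn u k)
      with (- 2 * B * (k * dn u k * sn u k)) by ring.
    nra.
  - replace (2 * k ^ 2 * sn u k ^ 2) with (2 * (k ^ 2 * sn u k ^ 2)) by ring.
    nra.
Qed.

Lemma limit_forced_solution (k B s : R) : 0 < k < 1 -> 0 < B ->
  forced_solution 1 0 0 0 0 (fun _ => 0) (fun _ => 0) (fun _ => 0)
    (fun t => limX k B (s + t)) (fun t => limY k B (s + t))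
    (fun t => limZ k B (s + t)).
Proof.
  intros Hk HB.
  assert (Hcomp : forall (f : R -> R) (t l : R), is_derive f (s + t) l ->
            is_derive (fun x : R => f (s + x)) t l).
  { intros f t l Hf; replace l with (1 * l) by ring.
    apply (is_derive_comp f (fun x : R => s + x)); [exact Hf|].
    auto_derive; [easy|ring]. }
  assert (HX := fun t => Hcomp _ _ _ (is_derive_limX k B (s + t) Hk HB)).
  assert (HY := fun t => Hcomp _ _ _ (is_derive_limY k B (s + t) Hk HB)).
  assert (HZ := fun t => Hcomp _ _ _ (is_derive_limZ k B (s + t) Hk HB)).
  split.
  - intros t; repeat split;
      apply (ex_derive_continuous (K := R_AbsRing) (V := R_NormedModule));
      eexists; [apply HX|apply HY|apply HZ].
  - intros t _.
    replace (1 * limY k B (s + t) - 0 * limX k B (s + t) + 0)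
      with (limY k B (s + t)) by ring.
    replace (0 * limX k B (s + t) - 0 * limY k B (s + t)
             - limX k B (s + t) * limZ k B (s + t) + 0)
      with (- limX k B (s + t) * limZ k B (s + t)) by ring.
    replace (limX k B (s + t) * limY k B (s + t) - 0 * limZ k B (s + t) + 0)
      with (limX k B (s + t) * limY k B (s + t)) by ring.
    exact (conj (HX t) (conj (HY t) (HZ t))).
Qed.

Definition near3 (r x1 y1 z1 x2 y2 z2 : R) : Prop :=
  Rabs (x1 - x2) <= r /\ Rabs (y1 - y2) <= r /\ Rabs (z1 - z2) <= r.

Lemma Rabs_near (M r x y : R) :
  Rabs y <= M -> Rabs (x - y) <= r -> Rabs x <= M + r.
Proof.
  intros Hy Hxy; replace x with (y + (x - y)) by ring.
  apply Rle_trans with (1 := Rabs_triang _ _); lra.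
Qed.

Lemma continuous_shift (g : R -> R) (s : R) :
  (forall t, continuous g t) -> forall t, continuous (fun r => g (s + r)) t.
Proof.
  intros Hg t; apply (continuous_comp (fun r : R => s + r) g); [|apply Hg].
  apply (ex_derive_continuous (K := R_AbsRing) (V := R_NormedModule)).
  now auto_derive.
Qed.

(** The limit solution is started at a point [s] near the initial point of the given one. Over the
    window the two stay within a multiple of [eps], and the limit integral is [I] whatever [s] is.
    Closeness at later times serves only to keep the solution bounded, which makes [N] independent
    of [eps]. *)
Lemma window_near_limit (sigma beta k B C : R) (phi : R -> R) (I : R) :
  0 < sigma -> 0 < beta -> 0 < k < 1 -> 0 < B -> 0 <= C ->
  locally_lipschitz phi ->
  (forall s, RInt (fun r => phi (limZ k B (s + r))) 0 (window k B) = I) ->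
  exists N, 0 <= N /\ forall eps gX gY gZ, 0 < eps <= 1 ->
    rescaled_solution sigma beta eps gX gY gZ ->
    (forall t, exists s, near3 (C * eps) (gX t) (gY t) (gZ t)
                           (limX k B s) (limY k B s) (limZ k B s)) ->
    Rabs (RInt (fun r => phi (gZ r)) 0 (window k B) - I) <= N * eps.
Proof.
  intros Hsigma Hbeta Hk HB HC Hphi HI.
  set (M0 := 2 * sqrt B + 3 * B).
  assert (HM0 : 0 <= M0) by (unfold M0; assert (H := sqrt_pos B); lra).
  set (M := M0 + C).
  assert (HT := window_pos k B Hk HB).
  destruct (forced_solution_dist 1 M (window k B)) as [C1 [HC1 Hdist]];
    [lra|unfold M; lra|lra|].
  destruct (Hphi M) as [Lam [HLam Hlip]]; [unfold M; lra|].
  (* [r0 * eps] dominates the initial distance [C * eps] and the three terms of order [eps] treated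
     as forcing. *)
  set (r0 := C + sigma * M + M + beta * (M + sigma)).
  assert (HM : 0 <= M) by (unfold M; lra).
  assert (HsM : 0 <= sigma * M) by nra.
  assert (HbM : 0 <= beta * (M + sigma)) by nra.
  assert (Hr0 : 0 <= r0) by (unfold r0; lra).
  exists (window k B * (Lam * (C1 * r0))); split.
  { apply Rmult_le_pos; [lra|]; apply Rmult_le_pos; [lra|].
    apply Rmult_le_pos; lra. }
  intros eps gX gY gZ Heps Hsol Hnear.
  assert (Hlim := limit_bounded k B Hk HB); fold M0 in Hlim.
  assert (Hbd : forall t, Rabs (gX t) <= M /\ Rabs (gY t) <= M /\ Rabs (gZ t) <= M).
  { intros t; destruct (Hnear t) as [s [Hx [Hy Hz]]].
    destruct (Hlim s) as [Lx [Ly Lz]].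
    assert (C * eps <= C) by nra.
    assert (Bx := Rabs_near _ _ _ _ Lx Hx).
    assert (By := Rabs_near _ _ _ _ Ly Hy).
    assert (Bz := Rabs_near _ _ _ _ Lz Hz).
    unfold M; lra. }
  destruct (Hnear 0) as [s [Hx [Hy Hz]]].
  assert (Hf : forced_solution 1 0 0 0 0 (fun t => - (eps * sigma * gX t))
     (fun t => - (eps * gY t)) (fun t => - (eps * beta * (gZ t + sigma))) gX gY gZ)
    by (apply (forced_solution_ext _ _ _ _ _ _ _ _ _ _ _ _ _ _ _ _ _ _ _ Hsol);
        intros; ring).
  assert (Hone : Rabs 1 <= 1) by (rewrite Rabs_R1; lra).
  assert (Hzero : Rabs 0 <= 1) by (rewrite Rabs_R0; lra).
  assert (HCr : C * eps <= r0 * eps)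
    by (apply Rmult_le_compat_r; [lra|unfold r0; lra]).
  assert (HD := Hdist 1 0 0 0 0 Hone Hzero Hzero Hzero Hzero
    _ _ _ _ _ _ _ _ _ _ _ _ (r0 * eps) Hf (limit_forced_solution k B s Hk HB)).
  assert (Hclose : forall t, 0 <= t <= window k B ->
            Rabs (gZ t - limZ k B (s + t)) <= C1 * (r0 * eps)).
  { intros t Ht; apply HD; try exact Ht.
    - intros x _; apply Hbd.
    - intros x _; destruct (Hlim (s + x)) as [Lx [Ly Lz]]; unfold M; lra.
    - intros x _; destruct (Hbd x) as [Bx [By Bz]].
      assert (Hscale : forall q, Rabs q <= r0 -> Rabs (- (eps * q) - 0) <= r0 * eps).
      { intros q Hq; rewrite Rminus_0_r, Rabs_Ropp, Rabs_mult, Rabs_pos_eq by lra.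
        rewrite Rmult_comm; apply Rmult_le_compat_r; lra. }
      rewrite !Rmult_assoc; repeat split; apply Hscale.
      + rewrite Rabs_mult, (Rabs_pos_eq sigma) by lra.
        assert (sigma * Rabs (gX x) <= sigma * M) by nra.
        unfold r0; lra.
      + unfold r0; lra.
      + rewrite Rabs_mult, (Rabs_pos_eq beta) by lra.
        assert (Rabs (gZ x + sigma) <= M + sigma).
        { apply Rle_trans with (1 := Rabs_triang _ _).
          rewrite (Rabs_pos_eq sigma); lra. }
        assert (beta * Rabs (gZ x + sigma) <= beta * (M + sigma)) by nra.
        unfold r0; lra.
    - rewrite Rplus_0_r; lra.
    - rewrite Rplus_0_r; lra.
    - rewrite Rplus_0_r; lra. }
  rewrite <- (HI s).
  replace (window k B * (Lam * (C1 * r0)) * eps)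
    with (window k B * (Lam * (C1 * (r0 * eps)))) by ring.
  destruct Hf as [Hcf _].
  destruct (limit_forced_solution k B s Hk HB) as [Hcl _].
  apply RInt_dist; [lra| | |].
  - intros t; apply (continuous_comp gZ phi); [apply Hcf|].
    now apply locally_lipschitz_continuous.
  - intros t; apply (continuous_comp (fun t => limZ k B (s + t)) phi); [apply Hcl|].
    now apply locally_lipschitz_continuous.
  - intros t Ht.
    apply Rle_trans with (Lam * Rabs (gZ t - limZ k B (s + t))).
    + apply Hlip; [apply Hbd|].
      destruct (Hlim (s + t)) as [Lx [Ly Lz]]; unfold M; lra.
    + apply Rmult_le_compat_l; [exact HLam|now apply Hclose].
Qed.

Lemma RInt_period (g : R -> R) (T s : R) :
  (forall t, continuous g t) -> (forall t, g (t + T) = g t) ->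
  RInt (fun r => g (s + r)) 0 T = RInt g 0 T.
Proof.
  intros Hg Hper.
  set (G := (fun x => RInt g 0 x) : R -> R).
  assert (HG : forall x : R, is_derive G x (g x))
    by (intros x; apply is_derive_primitive, Hg).
  assert (HU : forall x : R, Derive (fun y : R => G y) x = g x)
    by (intros x; apply is_derive_unique, HG).
  rewrite RInt_shift by exact Hg.
  assert (HCh := RInt_Chasles (V := R_CompleteNormedModule) g 0 s (s + T)
    (ex_RInt_continuous_all g 0 s Hg) (ex_RInt_continuous_all g s (s + T) Hg)).
  change (G s + RInt g s (s + T) = G (s + T)) in HCh.
  assert (H0 : G 0 = 0) by apply (RInt_point (V := R_CompleteNormedModule)).
  change (RInt g s (s + T) = G T).
  clearbody G.
  assert (Hconst : G (s + T) - G s = G (0 + T) - G 0).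
  { apply (is_derive_0_const (fun x => G (x + T) - G x)).
    intros t; auto_derive; [repeat split; eexists; apply HG|].
    rewrite !HU, Hper; ring. }
  rewrite Rplus_0_l in Hconst; lra.
Qed.

(** At each late time [t] a point of the orbit within [r] of the solution is chosen; for one period
    [T] the two solutions stay within [C1 * r]. The integral over a period does not depend on the
    chosen point, so the window errors tend to [0] with [r]. *)
Lemma time_average_attracted (sigma beta eps T M : R) (phi gX gY gZ X Y Z : R -> R) :
  0 < T -> 0 <= M -> locally_lipschitz phi ->
  (forall s, rescaled_solution sigma beta eps
     (fun t => gX (s + t)) (fun t => gY (s + t)) (fun t => gZ (s + t))) ->
  (forall t, gZ (t + T) = gZ t) ->
  (forall t, Rabs (gX t) <= M /\ Rabs (gY t) <= M /\ Rabs (gZ t) <= M) ->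
  rescaled_solution sigma beta eps X Y Z ->
  (forall r, 0 < r -> exists t0, forall t, t0 <= t ->
     exists s, near3 r (X t) (Y t) (Z t) (gX s) (gY s) (gZ s)) ->
  is_time_average (fun t => phi (Z t)) (RInt (fun r => phi (gZ r)) 0 T / T).
Proof.
  intros HT HM Hphi Hg Hper Hbd HX Hconv.
  assert (HcZ : forall t, continuous (fun t => phi (Z t)) t).
  { intros t; apply (continuous_comp Z phi); [apply HX|].
    now apply locally_lipschitz_continuous. }
  assert (HcgZ : forall t, continuous gZ t).
  { intros t; destruct (Hg 0) as [Hc _]; destruct (Hc t) as [_ [_ H]].
    apply continuous_ext with (2 := H); intros x; now rewrite Rplus_0_l. }
  assert (HcG : forall t, continuous (fun t => phi (gZ t)) t).
  { intros t; apply (continuous_comp gZ phi); [apply HcgZ|].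
    now apply locally_lipschitz_continuous. }
  apply is_time_average_windows; [exact HT|exact HcZ|].
  set (A := 1 + Rabs (eps * sigma) + Rabs eps + Rabs (eps * beta)).
  assert (P1 := Rabs_pos (eps * sigma)). assert (P2 := Rabs_pos eps).
  assert (P3 := Rabs_pos (eps * beta)).
  destruct (forced_solution_dist A (M + 1) T) as [C1 [HC1 Hdist]];
    [unfold A; lra|lra|lra|].
  destruct (Hphi (M + 1)) as [Lam [HLam Hlip]]; [lra|].
  intros delta Hdelta.
  assert (HTL : 0 <= T * (Lam * C1))
    by (apply Rmult_le_pos; [lra|now apply Rmult_le_pos]).
  (* The cap [1] keeps the attracted solution inside the bound [M + 1] used for [C1] and [Lam]; the
     [+ 1] in the denominator guards against division by zero. *)
  set (r := Rmin 1 (delta / (T * (Lam * C1) + 1))).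
  assert (Hr : 0 < r).
  { apply Rmin_glb_lt; [lra|apply Rdiv_lt_0_compat; lra]. }
  assert (Hr1 : r <= 1) by apply Rmin_l.
  assert (Hr2 : T * (Lam * C1) * r <= delta).
  { assert (H : r <= delta / (T * (Lam * C1) + 1)) by apply Rmin_r.
    apply (Rmult_le_compat_r (T * (Lam * C1) + 1)) in H; [|lra].
    replace (delta / (T * (Lam * C1) + 1) * (T * (Lam * C1) + 1)) with delta in H
      by (field; lra).
    lra. }
  destruct (Hconv r Hr) as [t0 Ht0].
  exists (Rmax 0 t0); split; [apply Rmax_l|].
  intros t Ht.
  assert (Htpos : 0 <= t) by (apply Rle_trans with (2 := Ht), Rmax_l).
  assert (Htt0 : t0 <= t) by (apply Rle_trans with (2 := Ht), Rmax_r).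
  destruct (Ht0 t Htt0) as [s [Hx [Hy Hz]]].
  rewrite <- (RInt_period (fun x => phi (gZ x)) T s HcG)
    by (intros; now rewrite Hper).
  assert (HbX : bounded_on (M + 1) T (fun x => X (t + x)) (fun x => Y (t + x))
                  (fun x => Z (t + x))).
  { intros x Hx'; destruct (Ht0 (t + x) ltac:(lra)) as [s' [Nx [Ny Nz]]].
    destruct (Hbd s') as [Bx [By Bz]].
    assert (Cx := Rabs_near _ _ _ _ Bx Nx).
    assert (Cy := Rabs_near _ _ _ _ By Ny).
    assert (Cz := Rabs_near _ _ _ _ Bz Nz).
    lra. }
  assert (HbG : bounded_on (M + 1) T (fun x => gX (s + x)) (fun x => gY (s + x))
                  (fun x => gZ (s + x))).
  { intros x _; destruct (Hbd (s + x)) as [Bx [By Bz]]; lra. }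
  assert (HXs := forced_solution_shift _ _ _ _ _ _ _ _ _ _ _ t Htpos HX).
  assert (Hone : Rabs 1 <= A) by (rewrite Rabs_R1; unfold A; lra).
  assert (Hzero : Rabs 0 <= A) by (rewrite Rabs_R0; unfold A; lra).
  assert (HD := Hdist 1 (eps * sigma) 0 eps (eps * beta) Hone
    ltac:(unfold A; lra) Hzero ltac:(unfold A; lra) ltac:(unfold A; lra)
    _ _ _ _ _ _ _ _ _ _ _ _ r HXs (Hg s) HbX HbG).
  apply Rle_trans with (T * (Lam * (C1 * r))).
  2: { apply Rle_trans with (2 := Hr2); apply Req_le; ring. }
  apply RInt_dist; [lra| | |].
  - apply (continuous_shift (fun x => phi (Z x)) t HcZ).
  - apply (continuous_shift (fun x => phi (gZ x)) s HcG).
  - intros x Hx'.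
    apply Rle_trans with (Lam * Rabs (Z (t + x) - gZ (s + x))).
    + apply Hlip; [apply HbX, Hx'|apply HbG, Hx'].
    + apply Rmult_le_compat_l; [exact HLam|].
      apply HD; [|rewrite !Rplus_0_r; assumption ..|exact Hx'].
      intros y _; rewrite !Rminus_diag, Rabs_R0; lra.
Qed.

(** * From curves in [R3] to coordinates *)

Definition c1 (p : R3) : R := fst (fst p).
Definition c2 (p : R3) : R := snd (fst p).
Definition c3 (p : R3) : R := snd p.

Lemma is_derive_fst (U V : NormedModule R_AbsRing) (x : R -> U * V) (t : R) l :
  is_derive x t l -> is_derive (fun s => fst (x s)) t (fst l).
Proof.
  intros H.
  apply (filterdiff_comp x fst (fun y => scal y l) fst H).
  apply filterdiff_linear, is_linear_fst.
Qed.

Lemma is_derive_snd (U V : NormedModule R_AbsRing) (x : R -> U * V) (t : R) l :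
  is_derive x t l -> is_derive (fun s => snd (x s)) t (snd l).
Proof.
  intros H.
  apply (filterdiff_comp x snd (fun y => scal y l) snd H).
  apply filterdiff_linear, is_linear_snd.
Qed.

Lemma is_derive_coords (x : R -> R3) (t : R) (l : R3) :
  is_derive x t l ->
  is_derive (fun s => c1 (x s)) t (c1 l) /\
  is_derive (fun s => c2 (x s)) t (c2 l) /\
  is_derive (fun s => c3 (x s)) t (c3 l).
Proof.
  intros H.
  assert (Hf := is_derive_fst _ _ _ _ _ H).
  split; [apply (is_derive_fst _ _ _ _ _ Hf)|].
  split; [apply (is_derive_snd _ _ _ _ _ Hf)|apply (is_derive_snd _ _ _ _ _ H)].
Qed.

Lemma filterlim_coords (F : (R -> Prop) -> Prop) {FF : Filter F}
    (x : R -> R3) (l : R3) :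
  filterlim x F (locally l) ->
  filterlim (fun s => c1 (x s)) F (locally (c1 l)) /\
  filterlim (fun s => c2 (x s)) F (locally (c2 l)) /\
  filterlim (fun s => c3 (x s)) F (locally (c3 l)).
Proof.
  intros H.
  assert (Hb := proj1 (filterlim_locally _ _) H).
  split; [|split]; apply filterlim_locally; intros eps;
    generalize (Hb eps); apply filter_imp; intros s [[H1 H2] H3];
    [exact H1|exact H2|exact H3].
Qed.

Lemma norm_coords (p q : R3) (r : R) : norm (minus p q) <= r ->
  near3 r (c1 p) (c2 p) (c3 p) (c1 q) (c2 q) (c3 q).
Proof.
  intros H; destruct p as [[x1 y1] z1]; destruct q as [[x2 y2] z2].
  change (norm ((minus x1 x2, minus y1 y2), minus z1 z2) <= r) in H.
  destruct (norm_prod (minus x1 x2, minus y1 y2) (minus z1 z2)) as [H1 _].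
  destruct (norm_prod (minus x1 x2) (minus y1 y2)) as [H2 _].
  assert (H3 := Rle_trans _ _ _ H1 H).
  assert (H4 := Rle_trans _ _ _ (Rmax_l _ _) H3).
  assert (H5 := Rle_trans _ _ _ H2 H4).
  split; [|split].
  - exact (Rle_trans _ _ _ (Rmax_l _ _) H5).
  - exact (Rle_trans _ _ _ (Rmax_r _ _) H5).
  - exact (Rle_trans _ _ _ (Rmax_r _ _) H3).
Qed.

Lemma continuous_Rmax_0 (g : R -> R) :
  filterlim g (at_right 0) (locally (g 0)) ->
  (forall t, 0 < t -> continuous g t) ->
  forall t, continuous (fun s => g (Rmax 0 s)) t.
Proof.
  intros H0 Hg t.
  assert (Hm : forall s, s <= 0 -> Rmax 0 s = 0) by (intros; now apply Rmax_left).
  assert (Hp : forall s, 0 <= s -> Rmax 0 s = s) by (intros; now apply Rmax_right).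
  destruct (Rtotal_order t 0) as [Ht|[->|Ht]].
  - apply (continuous_ext_loc _ (fun _ => g 0)); [|apply continuous_const].
    assert (Hd : 0 < - t) by lra.
    exists (mkposreal _ Hd); intros s Hs.
    change (Rabs (s - t) < - t) in Hs; apply Rabs_lt_between in Hs.
    rewrite Hm; [reflexivity|lra].
  - apply filterlim_locally; intros eps.
    rewrite Hm by lra.
    destruct (proj1 (filterlim_locally _ _) H0 eps) as [d Hd].
    exists d; intros s Hs.
    destruct (Rle_or_lt s 0) as [Hs0|Hs0].
    + rewrite Hm by exact Hs0; apply ball_center.
    + rewrite Hp by lra; now apply Hd.
  - apply (continuous_ext_loc _ g); [|now apply Hg].
    exists (mkposreal _ Ht); intros s Hs.
    change (Rabs (s - t) < t) in Hs; apply Rabs_lt_between in Hs.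
    rewrite Hp; [reflexivity|lra].
Qed.

(* Freezing the curve at [x 0] for negative times makes it continuous on [R]. *)
Lemma forward_solution_coords (sigma beta rho : R) (x : R -> R3) :
  forward_solution (lorenz sigma beta rho) x ->
  forced_solution sigma sigma rho 1 beta (fun _ => 0) (fun _ => 0) (fun _ => 0)
    (fun t => c1 (x (Rmax 0 t))) (fun t => c2 (x (Rmax 0 t)))
    (fun t => c3 (x (Rmax 0 t))).
Proof.
  intros [Hd H0].
  assert (Hdc : forall t, 0 < t -> is_derive (fun s => c1 (x s)) t
             (sigma * c2 (x t) - sigma * c1 (x t) + 0) /\
           is_derive (fun s => c2 (x s)) t
             (rho * c1 (x t) - 1 * c2 (x t) - c1 (x t) * c3 (x t) + 0) /\
           is_derive (fun s => c3 (x s)) t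
             (c1 (x t) * c2 (x t) - beta * c3 (x t) + 0)).
  { intros t Ht; assert (H := is_derive_coords x t _ (Hd t Ht)).
    destruct (x t) as [[X Y] Z]; unfold lorenz in H.
    change (c1 (X, Y, Z)) with X; change (c2 (X, Y, Z)) with Y;
      change (c3 (X, Y, Z)) with Z.
    destruct H as [H1 [H2 H3]]; split; [|split].
    - replace (sigma * Y - sigma * X + 0) with (sigma * (Y - X)) by ring; exact H1.
    - replace (rho * X - 1 * Y - X * Z + 0) with (rho * X - Y - X * Z) by ring.
      exact H2.
    - replace (X * Y - beta * Z + 0) with (- beta * Z + X * Y) by ring; exact H3. }
  destruct (filterlim_coords (at_right 0) x (x 0) H0) as [L1 [L2 L3]].
  assert (Hcont : forall (f : R -> R) t l, is_derive f t l -> continuous f t).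
  { intros f t l Hf.
    apply (ex_derive_continuous (K := R_AbsRing) (V := R_NormedModule)).
    now exists l. }
  split.
  - intros t; repeat split.
    + apply (continuous_Rmax_0 (fun s => c1 (x s)) L1).
      intros s Hs; apply (Hcont _ _ _ (proj1 (Hdc s Hs))).
    + apply (continuous_Rmax_0 (fun s => c2 (x s)) L2).
      intros s Hs; apply (Hcont _ _ _ (proj1 (proj2 (Hdc s Hs)))).
    + apply (continuous_Rmax_0 (fun s => c3 (x s)) L3).
      intros s Hs; apply (Hcont _ _ _ (proj2 (proj2 (Hdc s Hs)))).
  - intros t Ht; rewrite (Rmax_right 0 t) by lra.
    assert (Hloc : forall (f : R3 -> R) l, is_derive (fun s => f (x s)) t l ->
              is_derive (fun s => f (x (Rmax 0 s))) t l).
    { intros f l Hf; apply is_derive_ext_loc with (2 := Hf).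
      exists (mkposreal _ Ht); intros s Hs.
      change (Rabs (s - t) < t) in Hs; apply Rabs_lt_between in Hs.
      rewrite Rmax_right; [reflexivity|lra]. }
    destruct (Hdc t Ht) as [H1 [H2 H3]].
    exact (conj (Hloc c1 _ H1) (conj (Hloc c2 _ H2) (Hloc c3 _ H3))).
Qed.

(** The distance estimate with [r = 0]. It is needed because [basin] provides some convergent
    solution from the initial point, whereas the averages concern any solution from it. *)
Lemma forced_solution_unique (a b c d e : R) (u v w X1 Y1 Z1 X2 Y2 Z2 : R -> R) :
  forced_solution a b c d e u v w X1 Y1 Z1 ->
  forced_solution a b c d e u v w X2 Y2 Z2 ->
  X1 0 = X2 0 -> Y1 0 = Y2 0 -> Z1 0 = Z2 0 ->
  forall t, 0 <= t -> X1 t = X2 t /\ Y1 t = Y2 t /\ Z1 t = Z2 t.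
Proof.
  intros H1 H2 HX HY HZ t Ht.
  assert (Hb : forall X Y Z, forced_solution a b c d e u v w X Y Z ->
            exists M, 0 <= M /\ bounded_on M t X Y Z).
  { intros X Y Z [Hc _].
    destruct (continuous_bounded X 0 t Ht) as [Mx [Px Bx]]; [apply Hc|].
    destruct (continuous_bounded Y 0 t Ht) as [My [Py By]]; [apply Hc|].
    destruct (continuous_bounded Z 0 t Ht) as [Mz [Pz Bz]]; [apply Hc|].
    exists (Mx + My + Mz); split; [lra|]; intros s Hs.
    specialize (Bx s Hs); specialize (By s Hs); specialize (Bz s Hs); lra. }
  destruct (Hb _ _ _ H1) as [M1 [P1 B1]]; destruct (Hb _ _ _ H2) as [M2 [P2 B2]].
  set (A := Rabs a + Rabs b + Rabs c + Rabs d + Rabs e).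
  assert (Qa := Rabs_pos a); assert (Qb := Rabs_pos b); assert (Qc := Rabs_pos c);
    assert (Qd := Rabs_pos d); assert (Qe := Rabs_pos e).
  destruct (forced_solution_dist A (M1 + M2) t) as [C [HC Hdist]];
    [unfold A; lra|lra|exact Ht|].
  assert (B1' : bounded_on (M1 + M2) t X1 Y1 Z1)
    by (intros s Hs; specialize (B1 s Hs); lra).
  assert (B2' : bounded_on (M1 + M2) t X2 Y2 Z2)
    by (intros s Hs; specialize (B2 s Hs); lra).
  destruct (Hdist a b c d e ltac:(unfold A; lra) ltac:(unfold A; lra)
    ltac:(unfold A; lra) ltac:(unfold A; lra) ltac:(unfold A; lra)
    _ _ _ _ _ _ _ _ _ _ _ _ 0 H1 H2 B1' B2') with t as [D1 [D2 D3]].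
  - intros s _; rewrite !Rminus_diag, Rabs_R0; lra.
  - rewrite HX, Rminus_diag, Rabs_R0; lra.
  - rewrite HY, Rminus_diag, Rabs_R0; lra.
  - rewrite HZ, Rminus_diag, Rabs_R0; lra.
  - lra.
  - rewrite Rmult_0_r in D1, D2, D3.
    apply Rabs_le_between in D1, D2, D3; lra.
Qed.

(** The inverse of [to_lorenz] with [t = eps * tau]; writing [rho] as [/ eps ^ 2] lets the powers of
    [eps] cancel. *)
Lemma lorenz_to_rescaled (sigma beta eps : R) (X Y Z : R -> R) :
  0 < sigma -> 0 < eps ->
  forced_solution sigma sigma (/ eps ^ 2) 1 beta
    (fun _ => 0) (fun _ => 0) (fun _ => 0) X Y Z ->
  rescaled_solution sigma beta eps
    (fun t => eps * X (eps * t)) (fun t => eps ^ 2 * sigma * Y (eps * t))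
    (fun t => sigma * (eps ^ 2 * Z (eps * t) - 1)).
Proof.
  intros Hsigma Heps [Hc Hd]; split.
  - intros t; destruct (Hc (eps * t)) as [H1 [H2 H3]].
    assert (Hce : continuous (fun s : R => eps * s) t).
    { apply (ex_derive_continuous (K := R_AbsRing) (V := R_NormedModule)).
      now auto_derive. }
    assert (Hsc : forall (f : R -> R) q, continuous f (eps * t) ->
              continuous (fun s => q * f (eps * s)) t).
    { intros f q Hf; apply (continuous_mult (K := R_AbsRing));
        [apply continuous_const|].
      now apply (continuous_comp (fun s : R => eps * s)). }
    repeat split; [now apply Hsc|now apply Hsc|].
    apply (continuous_mult (K := R_AbsRing)); [apply continuous_const|].
    apply (continuous_minus (V := R_NormedModule)); [now apply Hsc|].
    apply continuous_const.
  - intros t Ht; destruct (Hd (eps * t)) as [H1 [H2 H3]]; [nra|].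
    assert (D1 := is_derive_unique _ _ _ H1).
    assert (D2 := is_derive_unique _ _ _ H2).
    assert (D3 := is_derive_unique _ _ _ H3).
    assert (E1 : ex_derive X (eps * t)) by (eexists; exact H1).
    assert (E2 : ex_derive Y (eps * t)) by (eexists; exact H2).
    assert (E3 : ex_derive Z (eps * t)) by (eexists; exact H3).
    (split; [|split]); (auto_derive; [tauto|]);
      try change (Derive (fun x : R => X x) (eps * t)) with (Derive X (eps * t));
      try change (Derive (fun x : R => Y x) (eps * t)) with (Derive Y (eps * t));
      try change (Derive (fun x : R => Z x) (eps * t)) with (Derive Z (eps * t));
      rewrite ?D1, ?D2, ?D3; field; lra.
Qed.

(** A linear change of time leaves an average unchanged, and [q], later [rho ^ n], factors out. *)
Lemma is_time_average_rescale (f g : R -> R) (eps q l : R) :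
  0 < eps -> (forall t, continuous g t) ->
  (forall t, 0 < t -> f t = q * g (/ eps * t)) ->
  is_time_average g l -> is_time_average f (q * l).
Proof.
  intros Heps Hg Hfg Hl; apply is_time_average_iff; intros eta Heta.
  assert (Hq := Rabs_pos q).
  destruct (proj1 (is_time_average_iff g l) Hl (eta / (Rabs q + 1))) as [t1 Ht1].
  { apply Rdiv_lt_0_compat; lra. }
  exists (Rmax 0 (eps * t1)); intros t Ht.
  assert (Htpos : 0 < t) by (apply Rle_lt_trans with (2 := Ht), Rmax_l).
  assert (Ht' : eps * t1 < t) by (apply Rle_lt_trans with (2 := Ht), Rmax_r).
  assert (Hs : t1 < / eps * t).
  { apply Rmult_lt_reg_l with eps; [exact Heps|].
    rewrite <- Rmult_assoc, Rinv_r, Rmult_1_l by lra; exact Ht'. }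
  specialize (Ht1 _ Hs).
  assert (HR : RInt f 0 t = q * (eps * RInt g 0 (/ eps * t))).
  { transitivity (RInt (fun y => scal (q * eps) (scal (/ eps) (g (/ eps * y + 0)))) 0 t).
    - apply (RInt_ext (V := R_CompleteNormedModule)); intros y Hy.
      rewrite Rmin_left, Rmax_right in Hy by lra.
      change (f y = q * eps * (/ eps * g (/ eps * y + 0))).
      rewrite Hfg, Rplus_0_r by lra; field; lra.
    - assert (Hex : ex_RInt g (/ eps * 0 + 0) (/ eps * t + 0))
        by (apply ex_RInt_continuous_all, Hg).
      assert (HC := RInt_comp_lin (V := R_CompleteNormedModule) g (/ eps) 0 0 t Hex).
      assert (HS := RInt_scal (V := R_CompleteNormedModule)
                      (fun y => scal (/ eps) (g (/ eps * y + 0))) 0 t (q * eps)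
                      (ex_RInt_comp_lin (V := R_NormedModule) g _ _ _ _ Hex)).
      rewrite Rmult_0_r, !Rplus_0_r in HC.
      refine (eq_trans HS _).
      refine (eq_trans (f_equal (scal (q * eps)) HC) _).
      change (q * eps * RInt g 0 (/ eps * t) = q * (eps * RInt g 0 (/ eps * t))).
      ring. }
  rewrite HR.
  replace (/ t * (q * (eps * RInt g 0 (/ eps * t))) - q * l)
    with (q * (/ (/ eps * t) * RInt g 0 (/ eps * t) - l)) by (field; lra).
  rewrite Rabs_mult.
  apply Rle_trans with (Rabs q * (eta / (Rabs q + 1))).
  - now apply Rmult_le_compat_l.
  - apply Rmult_le_reg_r with (Rabs q + 1); [lra|].
    replace (Rabs q * (eta / (Rabs q + 1)) * (Rabs q + 1)) with (Rabs q * eta)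
      by (field; lra).
    nra.
Qed.

(** * Averages of powers of [Z] *)

(** Every shift [s] is provided, negative ones included, because [forced_solution] speaks only of
    positive times while the comparison may start anywhere on the orbit. *)
Lemma periodic_orbit_coords (sigma beta eps : R) (G : R3 -> Prop) :
  periodic_orbit (rescaled sigma beta eps) G ->
  exists (x : R -> R3) (T : R), 0 < T /\
    (forall t, x (t + T) = x t) /\ (forall p, G p <-> exists t, x t = p) /\
    forall s, rescaled_solution sigma beta eps (fun t => c1 (x (s + t)))
                (fun t => c2 (x (s + t))) (fun t => c3 (x (s + t))).
Proof.
  intros [x [T [HT [Hd [Hper [_ HG]]]]]].
  exists x, T; split; [exact HT|split; [exact Hper|split; [exact HG|]]].
  intros s.
  assert (Hcomp : forall (f : R -> R) (t l : R), is_derive f (s + t) l ->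
            is_derive (fun y : R => f (s + y)) t l).
  { intros f t l Hf; replace l with (1 * l) by ring.
    apply (is_derive_comp f (fun y : R => s + y)); [exact Hf|].
    auto_derive; [easy|ring]. }
  assert (HD : forall t,
    is_derive (fun y => c1 (x (s + y))) t
      (1 * c2 (x (s + t)) - eps * sigma * c1 (x (s + t)) + 0) /\
    is_derive (fun y => c2 (x (s + y))) t
      (0 * c1 (x (s + t)) - eps * c2 (x (s + t))
       - c1 (x (s + t)) * c3 (x (s + t)) + 0) /\
    is_derive (fun y => c3 (x (s + y))) t
      (c1 (x (s + t)) * c2 (x (s + t)) - eps * beta * c3 (x (s + t))
       + - (eps * beta * sigma))).
  { intros t; assert (H := is_derive_coords x (s + t) _ (Hd (s + t))).
    destruct (x (s + t)) as [[X Y] Z]; unfold rescaled in H.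
    change (c1 (X, Y, Z)) with X; change (c2 (X, Y, Z)) with Y;
      change (c3 (X, Y, Z)) with Z.
    destruct H as [H1 [H2 H3]]; split; [|split].
    - apply (Hcomp (fun y => c1 (x y))).
      replace (1 * Y - eps * sigma * X + 0) with (Y - eps * sigma * X) by ring.
      exact H1.
    - apply (Hcomp (fun y => c2 (x y))).
      replace (0 * X - eps * Y - X * Z + 0) with (- X * Z - eps * Y) by ring.
      exact H2.
    - apply (Hcomp (fun y => c3 (x y))).
      replace (X * Y - eps * beta * Z + - (eps * beta * sigma))
        with (X * Y - eps * beta * (Z + sigma)) by ring.
      exact H3. }
  split.
  - intros t; destruct (HD t) as [H1 [H2 H3]].
    split; [|split];
      apply (ex_derive_continuous (K := R_AbsRing) (V := R_NormedModule));
      eexists; eassumption.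
  - intros t _; apply HD.
Qed.

Lemma limit_orbit_coords (k B : R) (p : R3) : limit_orbit k B p ->
  exists s, c1 p = limX k B s /\ c2 p = limY k B s /\ c3 p = limZ k B s.
Proof. intros [tau ->]; now exists tau. Qed.

(** The period [T] of the orbit and the window length are unrelated, so their integrals cannot be
    compared directly. The long-time average of the orbit itself mediates: it equals the average
    over [T], and it can also be estimated by windows of the limit length. *)
Lemma attracted_average (sigma beta k B : R) (Gamma : R -> R3 -> Prop)
    (phi : R -> R) (I : R) :
  0 < sigma -> 0 < beta -> 0 < k < 1 -> 0 < B ->
  is_symmetric_orbit_family sigma beta k B Gamma ->
  locally_lipschitz phi ->
  (forall s, RInt (fun r => phi (limZ k B (s + r))) 0 (window k B) = I) ->
  exists N eps0, 0 < eps0 /\ forall eps, 0 < eps < eps0 ->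
  forall X Y Z, rescaled_solution sigma beta eps X Y Z ->
  (forall r, 0 < r -> exists t0, forall t, t0 <= t -> exists p, Gamma eps p /\
     near3 r (X t) (Y t) (Z t) (c1 p) (c2 p) (c3 p)) ->
  exists l, is_time_average (fun t => phi (Z t)) l /\
    Rabs (l - I / window k B) <= N * eps.
Proof.
  intros Hsigma Hbeta Hk HB [C [HC [d Hfam]]] Hphi HI.
  assert (HT0 := window_pos k B Hk HB).
  destruct (window_near_limit sigma beta k B C phi I) as [N [HN Hwin]];
    try assumption; [lra|].
  exists (N / window k B), (Rmin d 1).
  assert (Hd0 := cond_pos d).
  split; [apply Rmin_glb_lt; lra|].
  intros eps [Heps0 Heps1] X Y Z HX Hconv.
  assert (Hepsd : eps < d) by (apply Rlt_le_trans with (1 := Heps1), Rmin_l).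
  assert (Heps_1 : eps < 1) by (apply Rlt_le_trans with (1 := Heps1), Rmin_r).
  destruct (Hfam eps) as [Horb [_ [_ [Htube _]]]]; [|exact Heps0|].
  { change (Rabs (eps - 0) < d); rewrite Rminus_0_r, Rabs_pos_eq; lra. }
  destruct (periodic_orbit_coords _ _ _ _ Horb) as [x [T [HT [Hper [HG Hsol]]]]].
  assert (Hnear : forall t, exists s, near3 (C * eps) (c1 (x t)) (c2 (x t)) (c3 (x t))
            (limX k B s) (limY k B s) (limZ k B s)).
  { intros t; destruct (Htube (x t)) as [q [Hq Hn]]; [apply HG; now exists t|].
    destruct (limit_orbit_coords k B q Hq) as [s [E1 [E2 E3]]].
    exists s; rewrite <- E1, <- E2, <- E3; now apply norm_coords. }
  set (M := 2 * sqrt B + 3 * B + C * eps).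
  assert (HCe : 0 < C * eps) by nra.
  assert (HM : 0 <= M) by (unfold M; assert (H := sqrt_pos B); lra).
  assert (Hbd : forall t, Rabs (c1 (x t)) <= M /\ Rabs (c2 (x t)) <= M /\
                          Rabs (c3 (x t)) <= M).
  { intros t; destruct (Hnear t) as [s [N1 [N2 N3]]].
    destruct (limit_bounded k B Hk HB s) as [L1 [L2 L3]].
    exact (conj (Rabs_near _ _ _ _ L1 N1)
      (conj (Rabs_near _ _ _ _ L2 N2) (Rabs_near _ _ _ _ L3 N3))). }
  (* Used twice: for the attracted solution, and for the orbit, which is at distance zero from
     itself. *)
  assert (Havg : forall X Y Z, rescaled_solution sigma beta eps X Y Z ->
     (forall r, 0 < r -> exists t0, forall t, t0 <= t ->
        exists s, near3 r (X t) (Y t) (Z t) (c1 (x s)) (c2 (x s)) (c3 (x s))) ->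
     is_time_average (fun t => phi (Z t))
       (RInt (fun r => phi (c3 (x r))) 0 T / T)).
  { intros X' Y' Z' HX' Hc'.
    apply (time_average_attracted sigma beta eps T M phi (fun t => c1 (x t))
             (fun t => c2 (x t)) (fun t => c3 (x t)) X' Y' Z');
      try assumption.
    intros t; now rewrite Hper. }
  exists (RInt (fun r => phi (c3 (x r))) 0 T / T); split.
  - apply (Havg X Y Z HX); intros r Hr.
    destruct (Hconv r Hr) as [t0 Ht0]; exists t0; intros t Ht.
    destruct (Ht0 t Ht) as [p [Hp Hn]].
    destruct (proj1 (HG p) Hp) as [s Hs]; exists s; now rewrite Hs.
  - replace (N / window k B * eps) with (N * eps / window k B) by (field; lra).
    assert (Hx0 := Hsol 0).
    apply (time_average_dist (fun t => phi (c3 (x (0 + t))))).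
    + exact HT0.
    + nra.
    + intros t; apply (continuous_comp (fun t => c3 (x (0 + t))) phi);
        [apply Hx0|now apply locally_lipschitz_continuous].
    + apply (Havg _ _ _ Hx0); intros r Hr; exists 0; intros t _; exists (0 + t).
      unfold near3; rewrite !Rminus_diag, Rabs_R0; lra.
    + intros t _.
      replace (RInt (fun r => phi (c3 (x (0 + (t + r))))) 0 (window k B))
        with (RInt (fun r => phi (c3 (x (t + r)))) 0 (window k B)).
      * apply (Hwin eps _ _ _ ltac:(lra) (Hsol t)).
        intros s; apply Hnear.
      * apply (RInt_ext (V := R_CompleteNormedModule)).
        intros r _; now rewrite Rplus_0_l.
Qed.

Lemma Rpower_mhalf_sqr (rho : R) : 0 < rho -> / Rpower rho (- (1 / 2)) ^ 2 = rho.
Proof.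
  intros Hrho; rewrite <- Rpower_pow, Rpower_mult by apply exp_pos.
  rewrite <- Rpower_Ropp.
  replace (- (- (1 / 2) * INR 2)) with 1 by (simpl; field).
  now apply Rpower_1.
Qed.

Lemma lorenz_power_average (sigma beta k B : R) (Gamma : R -> R3 -> Prop)
    (n : nat) (a : R) :
  0 < sigma -> 0 < beta -> 0 < k < 1 -> 0 < B ->
  is_symmetric_orbit_family sigma beta k B Gamma ->
  (forall s, RInt (fun r => (limZ k B (s + r) * / sigma + 1) ^ n) 0 (window k B)
             = window k B * a) ->
  exists M rho0, forall rho, rho0 < rho ->
  forall P0, basin (lorenz sigma beta rho) (Xsym sigma rho Gamma) P0 ->
  forall x, forward_solution (lorenz sigma beta rho) x -> x 0 = P0 ->
  exists l, is_time_average (fun t => Zcoord (x t) ^ n) l /\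
    Rabs (l - rho ^ n * a) <= M * Rpower rho (INR n - 1 / 2).
Proof.
  intros Hsigma Hbeta Hk HB Hfam HI.
  assert (HT0 := window_pos k B Hk HB).
  destruct (attracted_average sigma beta k B Gamma
    (fun z => (z * / sigma + 1) ^ n) (window k B * a)) as [N [eps0 [Heps0 Hav]]];
    try assumption; [apply locally_lipschitz_affine_pow|].
  (* Since [rho = / eps ^ 2], the condition [/ eps0 ^ 2 < rho] means [eps < eps0]. *)
  exists N, (Rmax 0 (/ eps0 ^ 2)); intros rho Hrho P0 [y [Hy [Hy0 Hyconv]]] x Hx Hx0.
  assert (Hrho0 : 0 < rho) by (apply Rle_lt_trans with (2 := Hrho), Rmax_l).
  assert (Hrho1 : / eps0 ^ 2 < rho) by (apply Rle_lt_trans with (2 := Hrho), Rmax_r).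
  unfold Xsym in Hyconv; cbv zeta in Hyconv.
  assert (Hrhoeps := Rpower_mhalf_sqr rho Hrho0).
  set (eps := Rpower rho (- (1 / 2))) in *.
  assert (Heps : 0 < eps) by apply exp_pos.
  assert (Hlt : eps < eps0).
  { assert (Hi : / eps0 ^ 2 < / eps ^ 2) by lra.
    assert (eps ^ 2 < eps0 ^ 2).
    { apply Rinv_lt_cancel; [apply pow_lt, Heps0|exact Hi]. }
    nra. }
  assert (Hfx := forward_solution_coords _ _ _ _ Hx).
  assert (Hfy := forward_solution_coords _ _ _ _ Hy).
  rewrite <- Hrhoeps in Hfx, Hfy.
  assert (Heq : forall t, 0 <= t -> c1 (x t) = c1 (y t) /\ c2 (x t) = c2 (y t) /\
                                    c3 (x t) = c3 (y t)).
  { intros t Ht.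
    assert (H0 : x (Rmax 0 0) = y (Rmax 0 0))
      by (rewrite Rmax_left by lra; congruence).
    assert (H := forced_solution_unique _ _ _ _ _ _ _ _ _ _ _ _ _ _ Hfx Hfy
                   (f_equal c1 H0) (f_equal c2 H0) (f_equal c3 H0) t Ht).
    cbv beta in H; rewrite (Rmax_right 0 t Ht) in H; exact H. }
  assert (HX := lorenz_to_rescaled sigma beta eps _ _ _ Hsigma Heps Hfx).
  destruct (Hav eps (conj Heps Hlt) _ _ _ HX) as [l [Hl Hbound]].
  - intros r Hr.
    (* [Q] dominates the factors [eps], [eps ^ 2 * sigma] and [sigma * eps ^ 2] by which rescaling
       multiplies distances, so tolerance [r / Q] in the Lorenz variables gives [r] in the rescaled
       ones. *)
    set (Q := eps + eps ^ 2 * sigma).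
    assert (HQ1 : 0 < eps ^ 2 * sigma) by (apply Rmult_lt_0_compat; [apply pow_lt|]; assumption).
    assert (HQ : 0 < Q) by (unfold Q; lra).
    destruct (Hyconv (r / Q)) as [t0 Ht0]; [now apply Rdiv_lt_0_compat|].
    (* The [+ 1] produces the strict inequality [t0 < eps * t] demanded by a neighborhood of
       infinity. *)
    exists (Rmax 0 (/ eps * (t0 + 1))); intros t Ht.
    assert (Htpos : 0 <= t) by (apply Rle_trans with (2 := Ht), Rmax_l).
    assert (Hett : t0 < eps * t).
    { assert (H : / eps * (t0 + 1) <= t) by (apply Rle_trans with (2 := Ht), Rmax_r).
      apply (Rmult_le_compat_l eps) in H; [|lra].
      rewrite <- Rmult_assoc, Rinv_r in H by lra; lra. }
    assert (Het : 0 <= eps * t) by nra.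
    destruct (Ht0 _ Hett) as [q [[p [Hp Hq]] Hn]].
    exists p; split; [exact Hp|].
    rewrite (Rmax_right 0 (eps * t) Het).
    destruct (Heq _ Het) as [-> [-> ->]].
    apply norm_coords in Hn; destruct Hn as [N1 [N2 N3]].
    rewrite Hq in N1, N2, N3; destruct p as [[xi eta] zeta].
    unfold to_lorenz in N1, N2, N3.
    change (Rabs (c1 (y (eps * t)) - / eps * xi) <= r / Q) in N1.
    change (Rabs (c2 (y (eps * t)) - / eps ^ 2 * / sigma * eta) <= r / Q) in N2.
    change (Rabs (c3 (y (eps * t)) - / eps ^ 2 * (/ sigma * zeta + 1)) <= r / Q) in N3.
    change (near3 r (eps * c1 (y (eps * t))) (eps ^ 2 * sigma * c2 (y (eps * t)))
              (sigma * (eps ^ 2 * c3 (y (eps * t)) - 1)) xi eta zeta).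
    assert (Hscale : forall m z, 0 <= m <= Q -> Rabs z <= r / Q -> Rabs (m * z) <= r).
    { intros m z Hm Hz; rewrite Rabs_mult, (Rabs_pos_eq m) by lra.
      replace r with (Q * (r / Q)) by (field; lra).
      apply Rmult_le_compat; [lra|apply Rabs_pos|lra|exact Hz]. }
    split; [|split].
    + replace (eps * c1 (y (eps * t)) - xi)
        with (eps * (c1 (y (eps * t)) - / eps * xi)) by (field; lra).
      apply Hscale; [unfold Q; lra|exact N1].
    + replace (eps ^ 2 * sigma * c2 (y (eps * t)) - eta)
        with (eps ^ 2 * sigma * (c2 (y (eps * t)) - / eps ^ 2 * / sigma * eta))
        by (field; lra).
      apply Hscale; [unfold Q; lra|exact N2].
    + replace (sigma * (eps ^ 2 * c3 (y (eps * t)) - 1) - zeta)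
        with (eps ^ 2 * sigma * (c3 (y (eps * t)) - / eps ^ 2 * (/ sigma * zeta + 1)))
        by (field; lra).
      apply Hscale; [unfold Q; lra|exact N3].
  - exists (rho ^ n * l); split.
    + apply is_time_average_rescale with (eps := eps) (4 := Hl); [exact Heps| |].
      * intros t; destruct HX as [Hc _].
        apply (continuous_comp
                 (fun t => sigma * (eps ^ 2 * c3 (x (Rmax 0 (eps * t))) - 1))
                 (fun z => (z * / sigma + 1) ^ n)); [apply Hc|].
        apply locally_lipschitz_continuous, locally_lipschitz_affine_pow.
      * intros t Ht.
        replace (eps * (/ eps * t)) with t by (field; lra).
        rewrite Rmax_right, <- Rpow_mult_distr by lra.
        f_equal; rewrite <- Hrhoeps.
        destruct (x t) as [[X Y] Z]; change (c3 (X, Y, Z)) with Z;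
          unfold Zcoord; field; lra.
    + replace (rho ^ n * l - rho ^ n * a)
        with (rho ^ n * (l - window k B * a / window k B)) by (field; lra).
      assert (Hpow : 0 < rho ^ n) by (now apply pow_lt).
      rewrite Rabs_mult, (Rabs_pos_eq (rho ^ n)) by lra.
      (* The half power lost in the error term is the factor [eps = rho^(-1/2)]. *)
      replace (Rpower rho (INR n - 1 / 2)) with (rho ^ n * eps).
      2: { unfold eps; rewrite <- Rpower_pow, <- Rpower_plus by exact Hrho0.
           reflexivity. }
      replace (N * (rho ^ n * eps)) with (rho ^ n * (N * eps)) by ring.
      apply Rmult_le_compat_l; lra.
Qed.

(** * The leading coefficients *)

Lemma d1_pos (beta k : R) : 0 < beta -> 0 < k < 1 -> 0 < d1 beta k.
Proof.
  intros Hbeta Hk; unfold d1.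
  assert (H1 := e1_pos k Hk); assert (H2 := e2_nonneg k Hk); nra.
Qed.

(** The second equation of (S) is affine in [B], and the coefficient of [B] is exactly [d1]. *)
Lemma system_S_ratio (sigma beta k B : R) :
  0 < sigma -> 0 < beta -> 0 < k < 1 -> system_S sigma beta k B ->
  B / sigma = 3 * beta * (ellK k - 2 * ellE k) / d1 beta k.
Proof.
  intros Hsigma Hbeta Hk [_ H].
  assert (Hd := d1_pos beta k Hbeta Hk).
  apply Rmult_eq_reg_r with (sigma * d1 beta k); [|apply Rgt_not_eq; nra].
  replace (B / sigma * (sigma * d1 beta k)) with (B * d1 beta k) by (field; lra).
  replace (3 * beta * (ellK k - 2 * ellE k) / d1 beta k * (sigma * d1 beta k))
    with (3 * beta * sigma * (ellK k - 2 * ellE k)) by (field; lra).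
  unfold d1, e1, e2; lra.
Qed.

(** This fails for small [k], where [K] and [E] are both close to [PI / 2]. It is [B > 0] in the
    second equation of (S) that forces it, as [d1 > 0]. *)
Lemma ellK_gt_2ellE (sigma beta k B : R) :
  0 < sigma -> 0 < beta -> 0 < k < 1 -> 0 < B -> system_S sigma beta k B ->
  0 < ellK k - 2 * ellE k.
Proof.
  intros Hsigma Hbeta Hk HB HS.
  assert (Hr := system_S_ratio sigma beta k B Hsigma Hbeta Hk HS).
  assert (Hd := d1_pos beta k Hbeta Hk).
  assert (HBs : 0 < B / sigma) by (now apply Rdiv_lt_0_compat).
  replace (ellK k - 2 * ellE k) with (B / sigma * d1 beta k / (3 * beta)).
  2: { rewrite Hr; field; lra. }
  apply Rdiv_lt_0_compat; [now apply Rmult_lt_0_compat|lra].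
Qed.

(** Here and in the next two lemmas the right-hand side is the average of [(1 + (B / sigma) z) ^ n]
    with [z = 1 - 2 k^2 sn^2], for [n = 1, 2, 3], expanded by the binomial theorem. *)
Lemma coefZ1_mean (sigma k B : R) : 0 < sigma -> 0 < k < 1 ->
  coefZ1 sigma k B = 1 + B / sigma * mean1 k.
Proof.
  intros Hsigma Hk; assert (HK := ellK_pos k Hk).
  unfold coefZ1, mean1; field; lra.
Qed.

Lemma coefZ2_mean (sigma beta k B : R) :
  0 < sigma -> 0 < beta -> 0 < k < 1 -> system_S sigma beta k B ->
  coefZ2 beta k = 1 + 2 * (B / sigma) * mean1 k + (B / sigma) ^ 2 * mean2 k.
Proof.
  intros Hsigma Hbeta Hk HS; assert (HK := ellK_pos k Hk).
  assert (Hd := d1_pos beta k Hbeta Hk).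
  rewrite (system_S_ratio sigma beta k B) by assumption.
  unfold coefZ2, mean1, mean2; unfold d1 in *; field; lra.
Qed.

Lemma coefZ3_mean (sigma beta k B : R) :
  0 < sigma -> 0 < beta -> 0 < k < 1 -> system_S sigma beta k B ->
  coefZ3 beta k = 1 + 3 * (B / sigma) * mean1 k + 3 * (B / sigma) ^ 2 * mean2 k
                  + (B / sigma) ^ 3 * mean3 k.
Proof.
  intros Hsigma Hbeta Hk HS; assert (HK := ellK_pos k Hk).
  assert (Hd := d1_pos beta k Hbeta Hk).
  rewrite (system_S_ratio sigma beta k B) by assumption.
  unfold coefZ3, mean1, mean2, mean3; unfold d1 in *; field; lra.
Qed.

Lemma coefZ1_lt_1 (sigma beta k B : R) :
  0 < sigma -> 0 < beta -> 0 < k < 1 -> 0 < B -> system_S sigma beta k B ->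
  coefZ1 sigma k B < 1.
Proof.
  intros Hsigma Hbeta Hk HB HS; assert (HK := ellK_pos k Hk).
  assert (HKE := ellK_gt_2ellE sigma beta k B Hsigma Hbeta Hk HB HS).
  unfold coefZ1.
  replace (1 - 2 * ellE k / ellK k) with ((ellK k - 2 * ellE k) / ellK k)
    by (field; lra).
  assert (0 < B / sigma * ((ellK k - 2 * ellE k) / ellK k)); [|lra].
  apply Rmult_lt_0_compat; now apply Rdiv_lt_0_compat.
Qed.

Lemma coefZ2_lt_1 (sigma beta k B : R) :
  0 < sigma -> 0 < beta -> 0 < k < 1 -> 0 < B -> system_S sigma beta k B ->
  coefZ2 beta k < 1.
Proof.
  intros Hsigma Hbeta Hk HB HS; assert (HK := ellK_pos k Hk).
  assert (HKE := ellK_gt_2ellE sigma beta k B Hsigma Hbeta Hk HB HS).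
  assert (Hd := d1_pos beta k Hbeta Hk).
  assert (H1 := e1_pos k Hk); assert (H2 := e2_nonneg k Hk).
  unfold coefZ2.
  assert (0 < 3 * beta * (ellK k - 2 * ellE k) ^ 2 / (d1 beta k ^ 2 * ellK k)
              * (8 * e1 k + beta * e2 k)); [|lra].
  apply Rmult_lt_0_compat; [|nra].
  apply Rdiv_lt_0_compat; apply Rmult_lt_0_compat;
    try apply pow_lt; try assumption; lra.
Qed.

Theorem mainTheorem3 :
  forall (sigma beta : R), 0 < sigma -> 0 < beta ->
  (sigma + 1) / (beta + 2) > 2 / 3 ->
  forall (k B : R), 0 < k < 1 -> 0 < B -> system_S sigma beta k B ->
  forall (Gamma : R -> R3 -> Prop),
  is_symmetric_orbit_family sigma beta k B Gamma ->
  (exists M rho0 : R, forall rho : R, rho0 < rho ->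
     forall (P0 : R3), basin (lorenz sigma beta rho) (Xsym sigma rho Gamma) P0 ->
     forall (x : R -> R3), forward_solution (lorenz sigma beta rho) x -> x 0 = P0 ->
     exists L1 L2 L3 : R,
       is_time_average (fun t => Zcoord (x t)) L1 /\
       is_time_average (fun t => Zcoord (x t) ^ 2) L2 /\
       is_time_average (fun t => Zcoord (x t) ^ 3) L3 /\
       Rabs (L1 - rho * coefZ1 sigma k B) <= M * Rpower rho (1 / 2) /\
       Rabs (L2 - rho ^ 2 * coefZ2 beta k) <= M * Rpower rho (3 / 2) /\
       Rabs (L3 - rho ^ 3 * coefZ3 beta k) <= M * Rpower rho (5 / 2)) /\
  coefZ1 sigma k B < 1 /\ coefZ2 beta k < 1.
Proof.
  intros sigma beta Hsigma Hbeta _ k B Hk HB HS Gamma Hfam.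
  split; [|split; [now apply coefZ1_lt_1 with beta|now apply coefZ2_lt_1 with sigma B]].
  (* The coefficients [a0] to [a3] will be the binomial coefficients times powers of
     [b = B / sigma]. *)
  assert (Hcubic : forall n a0 a1 a2 a3 s,
    (forall z, (B * z * / sigma + 1) ^ n = a0 + a1 * z + a2 * z ^ 2 + a3 * z ^ 3) ->
    RInt (fun r => (limZ k B (s + r) * / sigma + 1) ^ n) 0 (window k B)
    = window k B * (a0 + a1 * mean1 k + a2 * mean2 k + a3 * mean3 k)).
  { intros n a0 a1 a2 a3 s Hpol.
    rewrite <- (RInt_window_cubic k B a0 a1 a2 a3 s Hk HB).
    apply (RInt_ext (V := R_CompleteNormedModule)); intros r _; cbv zeta.
    rewrite <- Hpol; f_equal; field; lra. }
  set (b := B / sigma).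
  destruct (lorenz_power_average sigma beta k B Gamma 1 (coefZ1 sigma k B)
              Hsigma Hbeta Hk HB Hfam) as [M1 [r1 H1]].
  { intros s; rewrite (Hcubic 1%nat 1 b 0 0)
      by (intros; unfold b; field; lra).
    rewrite coefZ1_mean by assumption; unfold b.
    apply (f_equal (Rmult (window k B))); ring. }
  destruct (lorenz_power_average sigma beta k B Gamma 2 (coefZ2 beta k)
              Hsigma Hbeta Hk HB Hfam) as [M2 [r2 H2]].
  { intros s; rewrite (Hcubic 2%nat 1 (2 * b) (b ^ 2) 0)
      by (intros; unfold b; field; lra).
    rewrite (coefZ2_mean sigma beta k B) by assumption; unfold b.
    apply (f_equal (Rmult (window k B))); ring. }
  destruct (lorenz_power_average sigma beta k B Gamma 3 (coefZ3 beta k)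
              Hsigma Hbeta Hk HB Hfam) as [M3 [r3 H3]].
  { intros s; rewrite (Hcubic 3%nat 1 (3 * b) (3 * b ^ 2) (b ^ 3))
      by (intros; unfold b; field; lra).
    rewrite (coefZ3_mean sigma beta k B) by assumption; unfold b.
    apply (f_equal (Rmult (window k B))); ring. }
  set (M := Rmax M1 (Rmax M2 M3)); exists M, (Rmax r1 (Rmax r2 r3)).
  assert (HM : M1 <= M /\ M2 <= M /\ M3 <= M).
  { unfold M; repeat split; [apply Rmax_l| |];
      (eapply Rle_trans; [|apply Rmax_r]); [apply Rmax_l|apply Rmax_r]. }
  intros rho Hrho P0 HP0 x Hx Hx0.
  apply Rmax_Rlt in Hrho; destruct Hrho as [Hr1 Hrho].
  apply Rmax_Rlt in Hrho; destruct Hrho as [Hr2 Hr3].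
  destruct (H1 rho Hr1 P0 HP0 x Hx Hx0) as [L1 [A1 B1]].
  destruct (H2 rho Hr2 P0 HP0 x Hx Hx0) as [L2 [A2 B2]].
  destruct (H3 rho Hr3 P0 HP0 x Hx Hx0) as [L3 [A3 B3]].
  assert (Hmono : forall m q, m <= M ->
            m * Rpower rho q <= M * Rpower rho q).
  { intros m q Hm; apply Rmult_le_compat_r; [apply Rlt_le, exp_pos|exact Hm]. }
  exists L1, L2, L3.
  split; [|split; [exact A2|split; [exact A3|split; [|split]]]].
  - apply is_lim_ext with (2 := A1); intros t; f_equal.
    apply (RInt_ext (V := R_CompleteNormedModule)); intros; apply pow_1.
  - replace (INR 1 - 1 / 2) with (1 / 2) in B1 by (simpl; field).
    rewrite pow_1 in B1; apply Rle_trans with (1 := B1), Hmono, HM.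
  - replace (INR 2 - 1 / 2) with (3 / 2) in B2 by (simpl; field).
    apply Rle_trans with (1 := B2), Hmono, HM.
  - replace (INR 3 - 1 / 2) with (5 / 2) in B3 by (simpl; field).
    apply Rle_trans with (1 := B3), Hmono, HM.
Qed.
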